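(* Let $p\ge3$, let $X\sim N_p(\theta,I_p)$ with unknown mean $\theta\in\mathbb{R}^p$, let $a>0$, and let $$\nu(d\theta)=\left(\frac{1}{a+\|\theta\|^2}\right)^{p/2}d\theta$$ on $\mathbb{R}^p$. Let $d>0$ be arbitrary and $f(\theta,\eta)=\|\theta-\eta\|^2+d$ for $\theta,\eta\in\mathbb{R}^p$. Then $\mathcal{F}_\nu$, the family of bounded perturbations of $\nu$, is strongly admissible with respect to $\Phi_f$; that is, for every $\nu_u\in\mathcal{F}_\nu$ and every $\varphi\in\Phi_f$, the formal Bayes estimator $\hat\varphi_u$ of $\varphi$ under the prior $\nu_u$ and squared error loss is almost-$\nu_u$ admissible.
   Context: $\|\cdot\|$ is the Euclidean norm, and $P(\cdot\mid\theta)$ denotes the $N_p(\theta,I_p)$ distribution on $\mathcal{X}=\mathbb{R}^p$. $\mathcal{F}_\nu$ is the family of all measures $\nu_u(d\theta)=u(\theta)\,\nu(d\theta)$ where $u:\mathbb{R}^p\to(0,\infty)$ is measurable and there is a constant $c>1$ with $1/c<u(\theta)<c$ for all $\theta$. The formal posterior $Q_u(d\theta\mid x)$ under the (improper) prior $\nu_u$ is the probability measure on $\mathbb{R}^p$ proportional to $\exp(-\|x-\theta\|^2/2)\,u(\theta)\,(a+\|\theta\|^2)^{-p/2}\,d\theta$. For measurable $\varphi:\mathbb{R}^p\to\mathbb{R}^q$ ($q\ge1$), the formal Bayes estimator of $\varphi$ is the posterior mean $\hat\varphi_u(x)=\int\varphi(\theta)\,Q_u(d\theta\mid x)$. $\Phi_f$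 is the class of all measurable $\varphi:\mathbb{R}^p\to\mathbb{R}^q$ ($q\ge1$) for which there is a constant $0<M_\varphi<\infty$ with $\|\varphi(\theta)-\varphi(\eta)\|^2\le M_\varphi f(\theta,\eta)$ for all $\theta,\eta\in\mathbb{R}^p$. The risk function of an estimator $\delta$ of $\varphi(\theta)$ is $\mathsf{R}(\delta;\theta)=\int\|\varphi(\theta)-\delta(x)\|^2\,P(dx\mid\theta)$. The estimator $\delta$ is almost-$\nu_u$ admissible if for every estimator $\delta_1$ with $\mathsf{R}(\delta_1;\theta)\le\mathsf{R}(\delta;\theta)$ for all $\theta$, the set $\{\theta:\mathsf{R}(\delta_1;\theta)<\mathsf{R}(\delta;\theta)\}$ has $\nu_u$-measure $0$. *)

(* Defs.v *)
From HB Require Import structures.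
From mathcomp Require Import all_boot all_order all_algebra.
From mathcomp Require Import all_classical all_reals all_analysis.
From mathcomp Require Import measurable_realfun.

Set Implicit Arguments.
Unset Strict Implicit.
Unset Printing Implicit Defensive.

Import Order.TTheory GRing.Theory Num.Theory.
Import numFieldNormedType.Exports.

Local Open Scope classical_set_scope.
Local Open Scope ring_scope.

(* The library equips tuples with the product sigma-algebra, so this is R^n
   with its Borel sets. *)
Notation vec R n := (n.-tuple (R : realType)).

Section euclidean.
Context {R : realType} {n : nat}.

Definition vsub (x y : vec R n) : vec R n := [tuple tnth x i - tnth y i | i < n].

Definition enorm (x : vec R n) : R := Num.sqrt (\sum_(i < n) tnth x i ^+ 2).

Lemma measurable_enorm : measurable_fun setT enorm.
Proof.
apply: (measurableT_comp (f := Num.sqrt : R -> R)).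
  by apply: continuous_measurable_fun; exact: sqrt_continuous.
apply: measurable_sum => i.
exact: (measurable_funX 2 (measurable_tnth i)).
Qed.

Lemma measurable_vsub (x : vec R n) : measurable_fun setT (vsub x).
Proof.
apply/measurable_fun_tnthP => i.
rewrite (_ : _ \o _ = fun y : vec R n => tnth x i - tnth y i); last first.
  by apply/funext => y; rewrite /= tnth_mktuple.
by apply: measurable_funB => //; exact: measurable_tnth.
Qed.

Lemma measurable_vsubl (y : vec R n) : measurable_fun setT (vsub ^~ y).
Proof.
apply/measurable_fun_tnthP => i.
rewrite (_ : _ \o _ = fun x : vec R n => tnth x i - tnth y i); last first.
  by apply/funext => x; rewrite /= tnth_mktuple.
by apply: measurable_funB => //; exact: measurable_tnth.
Qed.

End euclidean.

Section lebesgue_vec.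
Context {R : realType}.

Definition vcons n (x : measurableTypeR R * vec R n) : vec R n.+1 :=
  [tuple of (x.1 : R) :: x.2].

Lemma measurable_vcons n : measurable_fun setT (@vcons n).
Proof.
apply: (measurable_cons (f := fst : measurableTypeR R * vec R n -> R)) => //.
Qed.

Definition vuncons n (x : vec R n.+1) : measurableTypeR R * vec R n :=
  (thead x, [tuple of behead x]).

Lemma measurable_vuncons n : measurable_fun setT (@vuncons n).
Proof.
apply: (@measurable_fun_pair _ _ _ _ (measurableTypeR R)).
  exact: (measurable_tnth (ord0 : 'I_n.+1)).
exact: measurable_behead.
Qed.

Lemma vconsK n : cancel (@vcons n) (@vuncons n).
Proof. by case=> t x; congr pair => //; apply/val_inj. Qed.

Lemma vunconsK n : cancel (@vuncons n) (@vcons n).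
Proof. by move=> x; rewrite [RHS]tuple_eta. Qed.

(* The n-fold product of the Lebesgue measure on R, carried from
   R * R^n' to R^n'.+1 by vcons. *)
Fixpoint lebesgue_vec n : set (vec R n) -> \bar R :=
  match n with
  | 0 => \d_([tuple] : vec R 0)
  | n'.+1 => pushforward (@lebesgue_measure R \x @lebesgue_vec n')%E (@vcons n')
  end.

Section push_vcons.
Variables (n : nat)
  (mu : {sigma_finite_measure set (vec R n) -> \bar R}).

Definition push_vcons := pushforward (@lebesgue_measure R \x mu)%E (@vcons n).

Let push0 : push_vcons set0 = 0%E.
Proof. by rewrite /push_vcons /pushforward preimage_set0 measure0. Qed.

Let push_ge0 A : (0 <= push_vcons A)%E.
Proof. by rewrite /push_vcons /pushforward; exact: measure_ge0. Qed.

Let mpush A : measurable A -> measurable (@vcons n @^-1` A).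
Proof. by move=> mA; rewrite -[X in measurable X]setTI; exact: measurable_vcons. Qed.

Let push_sigma_additive : semi_sigma_additive push_vcons.
Proof.
move=> F mF tF mUF; rewrite /push_vcons /pushforward preimage_bigcup.
apply: measure_semi_sigma_additive.
- by move=> n'; exact: mpush.
- apply/trivIsetP => /= i j _ _ ij; rewrite -preimage_setI.
  by move/trivIsetP : tF => /(_ _ _ _ _ ij) ->//; rewrite preimage_set0.
- by rewrite -preimage_bigcup; exact: mpush.
Qed.

HB.instance Definition _ := isMeasure.Build _ _ _
  push_vcons push0 push_ge0 push_sigma_additive.

Let push_sigma_finite : sigma_finite setT push_vcons.
Proof.
have /sigma_finiteP[F [TF ndF Foo]] := sigma_finiteT (@lebesgue_measure R).
have /sigma_finiteP[G [TG ndG Goo]] := sigma_finiteT mu.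
exists (fun k => @vuncons n @^-1` (F k `*` G k)).
  rewrite -preimage_bigcup (_ : \bigcup_k _ = setT) ?preimage_setT//.
  apply/seteqP; split => // -[x y] _.
  have [i _ Fx] : (\bigcup_k F k) x by rewrite -TF.
  have [j _ Gy] : (\bigcup_k G k) y by rewrite -TG.
  exists (maxn i j) => //; split => /=.
    by move: Fx; exact/subsetPset/ndF/leq_maxl.
  by move: Gy; exact/subsetPset/ndG/leq_maxr.
move=> k; have [mF Fk] := Foo k; have [mG Gk] := Goo k; split.
  rewrite -[X in measurable X]setTI; apply: measurable_vuncons => //.
  exact: measurableX.
rewrite /push_vcons /pushforward -comp_preimage.
rewrite (_ : _ \o _ = id); last by apply/funext => x; exact: vconsK.
by rewrite preimage_id product_measure1E// lte_mul_pinfty// ge0_fin_numE.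
Qed.

HB.instance Definition _ :=
  Measure_isSigmaFinite.Build _ _ _ push_vcons push_sigma_finite.

End push_vcons.

Lemma lebesgue_vec_sigma_finite_measure n :
  {mu : {sigma_finite_measure set (vec R n) -> \bar R} |
    mu = @lebesgue_vec n :> (set (vec R n) -> \bar R)}.
Proof.
elim: n => [|n [mu muE]] /=; first by exists (\d_([tuple] : vec R 0)).
by exists (push_vcons mu); rewrite -muE.
Qed.

Section instances.
Variable n : nat.

Let mu0 : @lebesgue_vec n set0 = 0%E.
Proof. by have [mu <-] := lebesgue_vec_sigma_finite_measure n. Qed.

Let mu_ge0 A : (0 <= @lebesgue_vec n A)%E.
Proof. by have [mu <-] := lebesgue_vec_sigma_finite_measure n. Qed.

Let mu_sigma_additive : semi_sigma_additive (@lebesgue_vec n).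
Proof.
have [mu <-] := lebesgue_vec_sigma_finite_measure n.
exact: measure_semi_sigma_additive.
Qed.

HB.instance Definition _ := isMeasure.Build _ _ _
  (@lebesgue_vec n) mu0 mu_ge0 mu_sigma_additive.

Let mu_sigma_finite : sigma_finite setT (@lebesgue_vec n).
Proof.
have [mu <-] := lebesgue_vec_sigma_finite_measure n.
exact: sigma_finiteT.
Qed.

HB.instance Definition _ :=
  Measure_isSigmaFinite.Build _ _ _ (@lebesgue_vec n) mu_sigma_finite.

End instances.

Lemma lebesgue_vec_box n (A : 'I_n -> set R) :
  (forall i, measurable (A i)) ->
  lebesgue_vec [set x : vec R n | forall i, A i (tnth x i)] =
  (\prod_(i < n) (lebesgue_measure (A i : set (measurableTypeR R))))%E.
Proof.
elim: n A => [|n IHn] A mA.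
  by rewrite big_ord0 /= diracE mem_set//= => i; have := ltn_ord i.
have mB : measurable [set x : vec R n | forall i, A (lift ord0 i) (tnth x i)].
  rewrite [X in measurable X](_ : _ = \bigcap_(i in [set: 'I_n])
      ((@tnth n R ^~ i) @^-1` A (lift ord0 i))); last first.
    by apply/seteqP; split=> x /= H i => [_|]; exact: H.
  apply: fin_bigcap_measurable => // i _.
  by rewrite -[X in measurable X]setTI; exact: measurable_tnth.
rewrite big_ord_recl -IHn//.
rewrite /= /pushforward.
rewrite (_ : _ @^-1` _ = (A ord0 : set (measurableTypeR R)) `*`
    [set x : vec R n | forall i, A (lift ord0 i) (tnth x i)]); last first.
  apply/seteqP; split=> [[t x] /= H|[t x] /= [H0 H] i].
    split; first by have := H ord0.
    by move=> i; have := H (lift ord0 i); rewrite tnthS.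
  case: (unliftP ord0 i) => [j|] ->; first by rewrite tnthS; exact: H.
  exact: H0.
by rewrite product_measure1E//; exact: mA.
Qed.

End lebesgue_vec.

Section density.
Context d (T : measurableType d) (R : realType).
Variables (mu : {measure set T -> \bar R}) (f : T -> R).

(* The measure f(x) mu(dx); the proofs that f is measurable and nonnegative are
   arguments so that the measure structure is inferred. *)
Definition density (mf : measurable_fun setT f) (f0 : forall x, 0 <= f x) :
    set T -> \bar R :=
  fun A => (\int[mu]_(x in A) (f x)%:E)%E.

Hypotheses (mf : measurable_fun setT f) (f0 : forall x, 0 <= f x).

Let density0 : density mf f0 set0 = 0%E.
Proof. by rewrite /density integral_set0. Qed.

Let density_ge0 A : (0 <= density mf f0 A)%E.
Proof. by apply: integral_ge0 => x _; rewrite lee_fin. Qed.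

Let density_sigma_additive : semi_sigma_additive (density mf f0).
Proof.
apply: semi_sigma_additive_nng_induced; last by move=> x; rewrite lee_fin.
exact/measurable_EFinP.
Qed.

HB.instance Definition _ := isMeasure.Build _ _ _
  (density mf f0) density0 density_ge0 density_sigma_additive.

End density.

Section model.
Context {R : realType}.

Section normal.
Variable p : nat.

(* The N_p(theta, I_p) density. *)
Definition normal_vec_pdf (theta x : vec R p) : R :=
  (2 * pi) `^ (- (p%:R / 2)) * expR (- (enorm (vsub x theta) ^+ 2 / 2)).

Lemma measurable_gauss_l (theta : vec R p) :
  measurable_fun setT (fun x => expR (- (enorm (vsub x theta) ^+ 2 / 2))).
Proof.
apply: (measurableT_comp (@measurable_expR R)).
apply: measurableT_comp => //; apply: measurable_funM => //.
apply: (measurable_funX 2).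
exact: (measurableT_comp measurable_enorm (measurable_vsubl theta)).
Qed.

Lemma measurable_gauss_r (x : vec R p) :
  measurable_fun setT (fun theta => expR (- (enorm (vsub x theta) ^+ 2 / 2))).
Proof.
apply: (measurableT_comp (@measurable_expR R)).
apply: measurableT_comp => //; apply: measurable_funM => //.
apply: (measurable_funX 2).
exact: (measurableT_comp measurable_enorm (measurable_vsub x)).
Qed.

Lemma measurable_normal_vec_pdf theta :
  measurable_fun setT (normal_vec_pdf theta).
Proof. by apply: measurable_funM => //; exact: measurable_gauss_l. Qed.

Lemma normal_vec_pdf_ge0 theta x : 0 <= normal_vec_pdf theta x.
Proof. by rewrite mulr_ge0 ?powR_ge0 ?expR_ge0. Qed.

Definition normal_vec (theta : vec R p) : {measure set (vec R p) -> \bar R} :=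
  density (@lebesgue_vec R p) (measurable_normal_vec_pdf theta)
    (normal_vec_pdf_ge0 theta).

(* The risk, under squared error loss, of an estimator delta of phi(theta)
   from X ~ N_p(theta, I_p); it may be +oo. *)
Definition risk q (phi delta : vec R p -> vec R q) (theta : vec R p) : \bar R :=
  (\int[normal_vec theta]_x ((enorm (vsub (phi theta) (delta x)) ^+ 2)%:E))%E.

Definition almost_admissible (mu : {measure set (vec R p) -> \bar R}) q
    (phi delta : vec R p -> vec R q) : Prop :=
  forall delta1 : vec R p -> vec R q, measurable_fun setT delta1 ->
    (forall theta, risk phi delta1 theta <= risk phi delta theta)%E ->
    mu [set theta | risk phi delta1 theta < risk phi delta theta]%E = 0%E.

End normal.

Lemma measurable_invr : measurable_fun setT (fun x : R => x^-1).
Proof.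
rewrite (_ : (fun _ => _) = fun x : R => x * (x ^+ 2) `^ (-1)).
  apply: measurable_funM => //.
  exact: (measurableT_comp (measurable_powR (-1)) (exprn_measurable 2)).
apply/funext => x; rewrite powR_inv1 ?sqr_ge0//.
have [->|x0] := eqVneq x 0; first by rewrite mul0r invr0.
by rewrite expr2 invfM mulrA divff// mul1r.
Qed.

Lemma measurable_add_sqr_enorm p (a : R) :
  measurable_fun setT (fun theta : vec R p => a + enorm theta ^+ 2).
Proof.
apply: measurable_funD => //; apply: (measurable_funX 2).
exact: measurable_enorm.
Qed.

Section prior.
Variables (p : nat) (a : R).

Definition prior_density (theta : vec R p) : R :=
  (1 / (a + enorm theta ^+ 2)) `^ (p%:R / 2).

Lemma measurable_prior_density : measurable_fun setT prior_density.
Proof.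
apply: (measurableT_comp (measurable_powR _)); apply: measurable_funM => //.
exact: (measurableT_comp measurable_invr (measurable_add_sqr_enorm a)).
Qed.

Lemma prior_density_ge0 theta : 0 <= prior_density theta.
Proof. exact: powR_ge0. Qed.

Definition prior : {measure set (vec R p) -> \bar R} :=
  density (@lebesgue_vec R p) measurable_prior_density prior_density_ge0.

End prior.

(* The functions u indexing the bounded perturbations u(theta) nu(dtheta). *)
Record perturbation p := Perturbation {
  perturbation_fun :> vec R p -> R;
  measurable_perturbation : measurable_fun setT perturbation_fun;
  perturbation_bounded :
    exists2 c, 1 < c & forall theta, c^-1 < perturbation_fun theta < c }.

Lemma perturbation_ge0 p (u : perturbation p) theta : 0 <= u theta.
Proof.
have [c c1 /(_ theta)/andP[cu _]] := perturbation_bounded u.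
by rewrite (le_trans _ (ltW cu))// invr_ge0 (le_trans ler01)// ltW.
Qed.

Definition perturbed p (nu : {measure set (vec R p) -> \bar R})
    (u : perturbation p) : {measure set (vec R p) -> \bar R} :=
  density nu (measurable_perturbation u) (@perturbation_ge0 p u).

Section posterior.
Variables (p : nat) (a : R) (u : perturbation p).

Definition posterior_weight (x theta : vec R p) : R :=
  expR (- (enorm (vsub x theta) ^+ 2 / 2)) * u theta *
  (a + enorm theta ^+ 2) `^ (- (p%:R / 2)).

Lemma measurable_posterior_weight x : measurable_fun setT (posterior_weight x).
Proof.
apply: measurable_funM.
  apply: measurable_funM; first exact: measurable_gauss_r.
  exact: measurable_perturbation.
exact: (measurableT_comp (measurable_powR _) (measurable_add_sqr_enorm a)).
Qed.

Lemma posterior_weight_ge0 x theta : 0 <= posterior_weight x theta.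
Proof. by rewrite !mulr_ge0 ?powR_ge0 ?expR_ge0 ?perturbation_ge0. Qed.

(* mnormalize falls back on the Dirac mass when the total mass is 0 or +oo,
   which does not happen for a > 0. *)
Definition posterior (x : vec R p) : probability (vec R p) R :=
  mnormalize (density (@lebesgue_vec R p) (measurable_posterior_weight x)
    (posterior_weight_ge0 x)) \d_x.

Definition formal_bayes q (phi : vec R p -> vec R q) (x : vec R p) : vec R q :=
  [tuple \int[posterior x]_theta tnth (phi theta) i | i < q].

End posterior.

Definition growth_class p (f : vec R p -> vec R p -> R) q
    (phi : vec R p -> vec R q) : Prop :=
  measurable_fun setT phi /\
  exists2 M, 0 < M &
    forall theta eta, enorm (vsub (phi theta) (phi eta)) ^+ 2 <= M * f theta eta.

(* Strong admissibility of the family of bounded perturbations of prior p a, with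
   respect to the phi (into any R^q, q >= 1) in growth_class f; u ranges over
   the perturbations, so perturbed (prior p a) u over the whole family. *)
Definition strongly_admissible p (a : R) (f : vec R p -> vec R p -> R) : Prop :=
  forall (u : perturbation p) (q : nat) (phi : vec R p -> vec R q), (0 < q)%N ->
    growth_class f phi ->
    almost_admissible (perturbed (prior p a) u) phi (formal_bayes a u phi).

End model.

(* Main.v *)
Require Import Defs.
From HB Require Import structures.
From mathcomp Require Import all_boot all_order all_algebra.
From mathcomp Require Import all_classical all_reals all_analysis.
From mathcomp Require Import measurable_realfun.
From mathcomp Require Import ring lra.

Set Implicit Arguments.
Unset Strict Implicit.
Unset Printing Implicit Defensive.

Import Order.TTheory GRing.Theory Num.Theory.
Import numFieldNormedType.Exports.

Local Open Scope classical_set_scope.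
Local Open Scope ring_scope.

(** The argument is Blyth's method with an explicit sequence of finite priors.
Write w for the prior density, W(x, theta) for the unnormalized posterior
density, s for |x - theta|^2, and h(theta) = N / (N + |theta|^2), so that
h^2 nu_u is a finite measure which increases to nu_u as N grows.

Let delta be an estimator whose risk never exceeds that of the formal Bayes
estimator.  Weighting the risks by h^2 nu_u and integrating, with Tonelli, first
over theta and then over x turns the comparison into one for each x
([weighted_riskE]).  Fix x and a coordinate g of phi, with posterior mean mu.
Since g - mu has posterior mean zero, another value c can beat mu under the
weight h^2 only as far as h^2 is correlated with g; completing a square gives,
for every c,

  int h^2 (g - mu)^2 W <= int h^2 (g - c)^2 W + K int (h - h(x))^2 (g - mu)^2 W

([blyth_pointwise], [blyth_local]).

Three estimates control the error term.  By Peetre's inequality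
w(theta) <= K (1 + s)^p w(x) and conversely, so W(x, .) is w(x) times a Gaussian
centred at x up to polynomial factors, and every moment of 1 + s under W(x, .)
is of the exact order w(x) ([posterior_moment_le], [posterior_moment_ge]).  The
growth condition on phi then yields (g - mu)^2 <= C (1 + s)
([sqr_deviation_le]).  Finally (h - h(x))^2 <= 4 s / (N + |x|^2)
([sqr_cutoffB_le]).  The error at x is therefore O(w(x) / (N + |x|^2)).

For N = m^2 this is at most 1/m times a multiple of w(x) / sqrt(1 + |x|^2), which
is integrable because w decays like |x|^-p ([integral_prior_tail_lty]).  Hence
the weighted gain of delta over the formal Bayes estimator is O(1/m)
([blyth_bound]); the weights increase with m, so the gain vanishes
nu_u-almost everywhere ([blyth_null_gain]). *)

(** * Integration against densities and over R^n *)

Section density_integral.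
Local Open Scope ereal_scope.
Context d (T : measurableType d) (R : realType).
Variables (mu : {measure set T -> \bar R}) (f : T -> R).
Hypotheses (mf : measurable_fun setT f) (f0 : forall x, (0 <= f x)%R).

Import HBNNSimple.

Let nnsfun_density (g : {nnsfun T >-> R}) :
  \int[density mu mf f0]_x (g x)%:E = \int[mu]_x ((f x)%:E * (g x)%:E).
Proof.
under [LHS]eq_integral do rewrite fimfunE -fsumEFin//.
rewrite [LHS]ge0_integral_fsum//; last 2 first.
  - by move=> r; exact/measurable_EFinP/measurableT_comp.
  - by move=> n x _; rewrite EFinM nnfun_muleindic_ge0.
under [RHS]eq_integral.
  move=> x _; rewrite fimfunE -fsumEFin// ge0_mule_fsumr; last first.
    by move=> r; rewrite EFinM nnfun_muleindic_ge0.
  over.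
rewrite [RHS]ge0_integral_fsum//; last 2 first.
  - move=> r; apply: emeasurable_funM; first exact/measurable_EFinP.
    exact/measurable_EFinP/measurable_funM.
  - by move=> r x _; rewrite mule_ge0 ?lee_fin// -lee_fin EFinM nnfun_muleindic_ge0.
apply: eq_fsbigr => r _.
have mr : measurable (g @^-1` [set r]) by [].
have [r0|r0] := ltP r 0%R.
  rewrite preimage_nnfun0//.
  by rewrite !integral0_eq// => x _; rewrite indic0 mulr0 ?mule0.
under eq_integral do rewrite EFinM.
rewrite ge0_integralZl//; last exact/measurable_EFinP.
rewrite integral_indic// setIT /density -ge0_integralZl//; last 2 first.
  - exact/measurable_funTS/measurable_EFinP.
  - by move=> x _; rewrite lee_fin.
rewrite [LHS]integral_mkcond.
apply: eq_integral => x _; rewrite patchE indicE; case: ifP => xr.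
  by rewrite mulr1 muleC.
by rewrite mulr0 !mule0.
Qed.

Lemma ge0_integral_density (g : T -> \bar R) :
  measurable_fun setT g -> (forall x, 0 <= g x) ->
  \int[density mu mf f0]_x g x = \int[mu]_x ((f x)%:E * g x).
Proof.
move=> mg g0; pose g_ := nnsfun_approx measurableT mg.
have gE x : (g_ n x)%:E @[n --> \oo] --> g x by exact: cvg_nnsfun_approx.
have ndg x : {homo (fun n => (g_ n x)%:E) : a b / (a <= b)%N >-> a <= b}.
  by move=> a b ab; rewrite lee_fin; exact/lefP/nd_nnsfun_approx.
transitivity (limn (fun n => \int[density mu mf f0]_x (g_ n x)%:E)).
  rewrite -monotone_convergence//=.
  - by apply: eq_integral => x _; apply/esym/cvg_lim.
  - by move=> n; exact/measurable_EFinP.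
  - by move=> n x _; rewrite lee_fin.
transitivity (limn (fun n => \int[mu]_x ((f x)%:E * (g_ n x)%:E))).
  by congr (limn _); apply/funext => n; exact: nnsfun_density.
rewrite -monotone_convergence//=.
- by apply: eq_integral => x _; apply/cvg_lim => //; apply: cvgeZl.
- move=> n; apply: emeasurable_funM; exact/measurable_EFinP.
- by move=> n x _; rewrite mule_ge0 ?lee_fin.
- by move=> x _ m n mn; apply: lee_wpmul2l; [rewrite lee_fin|exact: ndg].
Qed.

End density_integral.

Section mnormalize_integral.
Local Open Scope ereal_scope.
Context d (T : measurableType d) (R : realType).
Variables (mu : {measure set T -> \bar R}) (P : probability T R).
Hypotheses (mu0 : 0 < mu setT) (muoo : mu setT < +oo).

(** Between the two degenerate cases of [mnormalize], it is a rescaling. *)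
Lemma integral_mnormalize (f : T -> R) : mu.-integrable setT (EFin \o f) ->
  \int[mnormalize mu P]_x (f x)%:E = (fine (mu setT))^-1%:E * \int[mu]_x (f x)%:E.
Proof.
move=> intf.
have z0 : (0 <= (fine (mu setT))^-1)%R by rewrite invr_ge0 fine_ge0.
have E : \int[mnormalize mu P]_x (f x)%:E =
    \int[mscale (NngNum z0) mu]_x (f x)%:E.
  apply: eq_measure_integral => A mA _.
  rewrite /= /mnormalize /mscale/= ifF; first by rewrite muleC.
  by rewrite gt_eqF//= lt_eqF.
have mf := measurable_int mu intf.
pose F : T -> \bar R := fun x => (f x)%:E.
have Hp : \int[mscale (NngNum z0) mu]_x F^\+ x = (fine (mu setT))^-1%:E * \int[mu]_x F^\+ x.
  by rewrite ge0_integral_mscale//; exact: measurable_funepos.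
have Hn : \int[mscale (NngNum z0) mu]_x F^\- x = (fine (mu setT))^-1%:E * \int[mu]_x F^\- x.
  by rewrite ge0_integral_mscale//; exact: measurable_funeneg.
rewrite E -[LHS]/(\int[mscale (NngNum z0) mu]_x F x) -[X in _ = _ * X]/(\int[mu]_x F x).
rewrite [LHS]integralE Hp Hn (integralE mu setT F).
rewrite (@muleBr _ _ (\int[mu]_x F^\+ x) (\int[mu]_x F^\- x))//.
apply: fin_num_adde_defl.
by rewrite fin_numN; exact: integrable_neg_fin_num.
Qed.

End mnormalize_integral.

Section tensor.
Local Open Scope ereal_scope.
Context {R : realType}.

Lemma integral_lebesgue_vecS n (f : vec R n.+1 -> \bar R) :
  measurable_fun setT f -> (forall x, 0 <= f x) ->
  \int[@lebesgue_vec R n.+1]_x f x =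
  \int[@lebesgue_measure R]_t \int[@lebesgue_vec R n]_x f (vcons (t, x)).
Proof.
move=> mf f0.
have mv := @measurable_vcons R n.
have mfv : measurable_fun setT (f \o @vcons R n) by exact: measurableT_comp.
rewrite -(fubini_tonelli1 (f \o @vcons R n))//; last by move=> x; exact: f0.
have := ge0_integral_pushforward mv (@lebesgue_measure R \x @lebesgue_vec R n)
  measurableT mf (fun x _ => f0 x).
rewrite preimage_setT => <-.
exact: eq_measure_integral.
Qed.

Lemma measurable_prod_tnth n (f : 'I_n -> R -> R) :
  (forall i, measurable_fun setT (f i)) ->
  measurable_fun setT (fun x : vec R n => (\prod_(i < n) f i (tnth x i))%R).
Proof.
move=> mf; apply: (@measurable_prod _ _ _ _ _ _ (fun i x => f i (tnth x i))) => i _.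
exact: (measurableT_comp (mf i) (measurable_tnth i)).
Qed.

Lemma integral_lebesgue_vec_prod n (f : 'I_n -> R -> R) :
  (forall i, measurable_fun setT (f i)) -> (forall i t, 0 <= f i t)%R ->
  \int[@lebesgue_vec R n]_x (\prod_(i < n) f i (tnth x i))%:E =
  \prod_(i < n) \int[@lebesgue_measure R]_t (f i t)%:E.
Proof.
elim: n f => [|n IH] f mf f0.
  rewrite big_ord0; under eq_integral do rewrite big_ord0.
  rewrite (_ : \int[_]_x _ = \int[\d_([tuple] : vec R 0)]_x 1).
    by rewrite integral_dirac// diracT mul1e.
  exact: eq_measure_integral.
rewrite integral_lebesgue_vecS//; last 2 first.
- by apply/measurable_EFinP; apply: measurable_prod_tnth => i; exact: mf.
- by move=> x; rewrite lee_fin prodr_ge0.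
rewrite big_ord_recl -IH// -ge0_integralZr//; last 3 first.
- by apply/measurable_EFinP; exact: mf.
- by move=> t _; rewrite lee_fin.
- by apply: integral_ge0 => x _; rewrite lee_fin prodr_ge0.
apply: eq_integral => t _.
rewrite -ge0_integralZl_EFin//; last 2 first.
- by move=> x _; rewrite lee_fin prodr_ge0.
- apply/measurable_EFinP.
  by apply: (measurable_prod_tnth (f := fun i => f (lift ord0 i))) => i; exact: mf.
apply: eq_integral => x _; rewrite -EFinM big_ord_recl; congr (_ * _)%:E.
by apply: eq_bigr => i _; rewrite tnthS.
Qed.

End tensor.

(** * Euclidean inequalities *)

Section euclid.
Context {R : realType} {n : nat}.
Implicit Types x y : vec R n.

Lemma sqr_enormE x : enorm x ^+ 2 = \sum_(i < n) tnth x i ^+ 2.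
Proof. by rewrite sqr_sqrtr// sumr_ge0// => i _; rewrite sqr_ge0. Qed.

Lemma sqr_enorm_vsubE x y :
  enorm (vsub x y) ^+ 2 = \sum_(i < n) (tnth x i - tnth y i) ^+ 2.
Proof. by rewrite sqr_enormE; apply: eq_bigr => i _; rewrite tnth_mktuple. Qed.

Lemma enorm_vsubC x y : enorm (vsub x y) = enorm (vsub y x).
Proof.
by congr Num.sqrt; apply: eq_bigr => i _; rewrite !tnth_mktuple -sqrrN opprB.
Qed.

Lemma measurable_sqr_enorm_vsub2 :
  measurable_fun setT (fun z : vec R n * vec R n => enorm (vsub z.1 z.2) ^+ 2).
Proof.
under eq_fun do rewrite sqr_enorm_vsubE.
apply: measurable_sum => i; apply: (measurable_funX 2); apply: measurable_funB.
  exact: (measurableT_comp (measurable_tnth i) measurable_fst).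
exact: (measurableT_comp (measurable_tnth i) measurable_snd).
Qed.

Lemma sqr_enorm_le x y :
  enorm x ^+ 2 <= 2 * enorm (vsub x y) ^+ 2 + 2 * enorm y ^+ 2.
Proof.
rewrite sqr_enorm_vsubE !sqr_enormE !mulr_sumr -big_split/=; apply: ler_sum => i _.
have := sqr_ge0 (tnth x i - 2 * tnth y i); lra.
Qed.

(** The discriminant argument, cleared of denominators: [B f - C g] has a
nonnegative sum of squares, equal to [B (A B - C^2)]. *)
Lemma cauchy_schwarz_sum (f g : 'I_n -> R) :
  (\sum_i f i * g i) ^+ 2 <= (\sum_i f i ^+ 2) * (\sum_i g i ^+ 2).
Proof.
set C := \sum_i f i * g i; set A := \sum_i f i ^+ 2; set B := \sum_i g i ^+ 2.
have B0 : 0 <= B by apply: sumr_ge0 => i _; exact: sqr_ge0.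
have : 0 <= \sum_i (B * f i - C * g i) ^+ 2.
  by apply: sumr_ge0 => i _; exact: sqr_ge0.
have -> : \sum_i (B * f i - C * g i) ^+ 2 = B * (A * B - C ^+ 2).
  rewrite (eq_bigr (fun i => B ^+ 2 * f i ^+ 2 - 2 * B * C * (f i * g i) +
     C ^+ 2 * g i ^+ 2)); last by move=> i _; ring.
  rewrite !big_split/= sumrN -!mulr_sumr -/A -/B -/C; ring.
have [B0'|] := ltP 0 B; first by rewrite pmulr_rge0// subr_ge0.
move=> Ble0 _; have {B0 Ble0} BE : B = 0 by lra.
suff -> : C = 0 by rewrite BE mulr0 expr0n.
apply: big1 => i _.
have /psumr_eq0P : B = 0 by [].
move=> /(_ (fun i _ => sqr_ge0 (g i))) /(_ i isT)/eqP.
by rewrite sqrf_eq0 => /eqP ->; rewrite mulr0.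
Qed.

(** The left-hand side is the square of the inner product of [x - y] and
[x + y]. *)
Lemma sqr_sub_sqr_enorm_le x y :
  (enorm x ^+ 2 - enorm y ^+ 2) ^+ 2 <=
  2 * enorm (vsub x y) ^+ 2 * (enorm x ^+ 2 + enorm y ^+ 2).
Proof.
rewrite [X in X ^+ 2](_ : _ =
    \sum_i (tnth x i - tnth y i) * (tnth x i + tnth y i)); last first.
  rewrite !sqr_enormE -sumrB; apply: eq_bigr => i _; ring.
apply: (le_trans (cauchy_schwarz_sum _ _)).
rewrite /= -sqr_enorm_vsubE [leRHS](_ : _ = enorm (vsub x y) ^+ 2 *
  (2 * (enorm x ^+ 2 + enorm y ^+ 2))); last by ring.
apply: ler_wpM2l; first exact: sqr_ge0.
rewrite !sqr_enormE -big_split/= mulr_sumr; apply: ler_sum => i _.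
have := sqr_ge0 (tnth x i - tnth y i); lra.
Qed.

End euclid.

(** * Gaussian and power integrals *)

Section one_dim.
Context {R : realType}.
Local Notation leb := (@lebesgue_measure R).

(** The normal density of mean [m] and variance [1 / (2 b)], without its
normalization; the value does not depend on [m]. *)
Lemma integral_gauss (b m : R) : 0 < b ->
  (\int[leb]_t (expR (- (b * (m - t) ^+ 2)))%:E = (Num.sqrt (pi / b))%:E)%E.
Proof.
move=> b0; pose s : R := Num.sqrt (b^-1 / 2).
have s2 : s ^+ 2 = b^-1 / 2 by rewrite sqr_sqrtr// divr_ge0// invr_ge0 ltW.
have s0 : s != 0.
  by rewrite gt_eqF// sqrtr_gt0 divr_gt0// invr_gt0.
have := @integral_normal_pdf R m s; rewrite normal_pdfE//.
have E (x : R) : normal_peak s * normal_fun m s x =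
    normal_peak s * expR (- (b * (m - x) ^+ 2)).
  rewrite /normal_fun; congr (_ * expR _).
  rewrite s2 mulNr -mulr_natr mulfVK// invrK mulrC; congr (- (_ * _)).
  by rewrite -sqrrN opprB.
under eq_integral => x _ do rewrite E EFinM.
have mg : measurable_fun setT (fun x : R => expR (- (b * (m - x) ^+ 2))).
  apply: (measurableT_comp (@measurable_expR R)); apply: measurableT_comp => //.
  apply: measurable_funM => //; apply: (measurable_funX 2).
  exact: measurable_funB.
rewrite ge0_integralZl//; last 2 first.
- exact/measurable_EFinP.
- by rewrite lee_fin normal_peak_ge0.
have pk : 0 < normal_peak s by exact: normal_peak_gt0.
move=> /(congr1 (mule (normal_peak s)^-1%:E)).
rewrite muleA -EFinM mulVf ?gt_eqF// mul1e mule1 => ->.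
by rewrite /normal_peak invrK s2 -mulr_natr; congr (Num.sqrt _)%:E; field; lra.
Qed.

Lemma continuous_1Dabs_powR (c : R) : continuous (fun t : R => (1 + `|t|) `^ c).
Proof.
move=> t.
have cf : {for t, continuous (fun t : R => 1 + `|t|)}.
  by apply: cvgD; [exact: cvg_cst|exact: norm_continuous].
have cg : {for (1 + `|t| : R), continuous (fun x : R => x `^ c)}.
  apply/differentiable_continuous/derivable1_diffP/derivable_powR.
  by rewrite in_itv/= andbT ltr_pwDl.
exact: (continuous_comp cf cg).
Qed.

Lemma cvg_1D_powRN (c : R) : 0 < c -> (1 + t) `^ (- c) @[t --> +oo%R] --> (0 : R).
Proof.
move=> c0; apply/cvgr0Pnorm_lt => e e0; near=> t.
have t0 : 0 <= t by near: t; apply: nbhs_pinfty_ge; rewrite num_real.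
have t1 : 0 < 1 + t by rewrite ltr_pwDl.
rewrite ger0_norm ?powR_ge0// powRN -(invrK e).
rewrite ltf_pV2 ?posrE ?invr_gt0 ?powR_gt0//.
rewrite (_ : e^-1 = (e^-1 `^ c^-1) `^ c); last first.
  by rewrite -powRrM mulVf ?gt_eqF// powRr1// invr_ge0 ltW.
rewrite gt0_ltr_powR ?nnegrE ?powR_ge0 ?(ltW t1)//.
by rewrite -ltrBlDl; near: t; apply: nbhs_pinfty_gt; rewrite num_real.
Unshelve. all: by end_near. Qed.

(** On the half-line, [- c^-1 (1 + t)^(- c)] is an antiderivative which vanishes
at infinity. *)
Lemma integral_1Dabs_powRN_lty (c : R) : 0 < c ->
  (\int[leb]_t ((1 + `|t|) `^ (- (1 + c)))%:E < +oo)%E.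
Proof.
move=> c0; rewrite ge0_symfun_integralT; last 3 first.
- by move=> t; exact: powR_ge0.
- exact: continuous_1Dabs_powR.
- by move=> t /=; rewrite normrN.
rewrite -set_itvcy (_ : integral _ _ _ =
    (\int[leb]_(t in `[0%R, +oo[) ((1 + t) `^ (- (1 + c)))%:E)%E); last first.
  by apply: eq_integral => t; rewrite inE/= in_itv/= andbT => t0; rewrite ger0_norm.
pose F (t : R) := - c^-1 * (1 + t) `^ (- c).
have dF (t : R) : 0 <= t -> is_derive t (1 : R) F ((1 + t) `^ (- (1 + c))).
  move=> t0; have t1 : 0 < 1 + t by rewrite ltr_pwDl.
  have d1 : is_derive t (1 : R) (fun t : R => 1 + t) 1.
    rewrite -[X in is_derive _ _ _ X]add0r; exact: is_deriveD.
  have d2 : is_derive (1 + t) (1 : R) (fun x : R => x `^ (- c)) (- c * (1 + t) `^ (- c - 1)).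
    exact: is_derive1_powR.
  have d3 := is_derive1_comp d2 d1.
  have -> : (1 + t) `^ (- (1 + c)) = - c^-1 *: (- c * (1 + t) `^ (- c - 1) * 1).
    rewrite /GRing.scale/= mulr1 mulNr mulNr mulrN opprK mulKf ?gt_eqF//.
    by congr (_ `^ _); ring.
  exact: is_deriveZ.
rewrite (@ge0_continuous_FTC2y _ _ F 0 0).
- by rewrite -EFinB -EFinM ltry.
- by move=> t _; exact: powR_ge0.
- apply: (@subspace_eq_continuous _ _ _ (fun t : R => (1 + `|t|) `^ (- (1 + c)))).
    by move=> t; rewrite inE/= in_itv/= andbT => t0; rewrite /from_subspace ger0_norm.
  by apply: continuous_subspaceT; exact: continuous_1Dabs_powR.
- rewrite -[X in _ --> X](mulr0 (- c^-1)); apply: cvgMr.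
  exact: cvg_1D_powRN.
- by move=> t t0; have [] := dF _ (ltW t0).
- apply: cvg_at_right_filter; apply/differentiable_continuous/derivable1_diffP.
  by have [] := dF 0 (lexx _).
- by move=> t; rewrite in_itv/= andbT => t0; have [? <-] := dF _ (ltW t0); rewrite derive1E.
Qed.

End one_dim.

Section gaussian_moments.
Context {R : realType} {p : nat}.
Implicit Types x y : vec R p.
Local Notation leb := (@lebesgue_vec R p).

Lemma measurable_comp_sqdist (f : R -> R) x : measurable_fun setT f ->
  measurable_fun setT (fun y => f (enorm (vsub x y) ^+ 2)).
Proof.
move=> mf; apply: (measurableT_comp mf); apply: (measurable_funX 2).
exact: (measurableT_comp measurable_enorm (measurable_vsub x)).
Qed.

Lemma integral_gauss_vec (b : R) x : 0 < b ->
  (\int[leb]_y (expR (- (b * enorm (vsub x y) ^+ 2)))%:E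
   = (Num.sqrt (pi / b) ^+ p)%:E)%E.
Proof.
move=> b0.
under eq_integral => y _ do rewrite sqr_enorm_vsubE mulr_sumr -sumrN expR_sum.
rewrite (integral_lebesgue_vec_prod
  (f := fun i t => expR (- (b * (tnth x i - t) ^+ 2)))); last 2 first.
- move=> i; apply: (measurableT_comp (@measurable_expR R)).
  apply: measurableT_comp => //; apply: measurable_funM => //.
  by apply: (measurable_funX 2); exact: measurable_funB.
- by move=> i t; exact: expR_ge0.
under eq_bigr do rewrite integral_gauss//.
by rewrite -(big_morph EFin EFinM erefl) prodr_const card_ord.
Qed.

Lemma measurable_gauss_fun (b : R) : measurable_fun setT (fun s => expR (- (b * s))).
Proof.
by apply: (measurableT_comp (@measurable_expR R)); apply: measurableT_comp.
Qed.

Lemma measurable_half_gauss : measurable_fun setT (fun s : R => expR (- (s / 2))).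
Proof.
apply: (measurableT_comp (@measurable_expR R)); apply: measurableT_comp => //.
exact: measurable_funM.
Qed.

(** Raise [1 + v <= expR v] to the power [n + 1] at [v = s / (4 (n + 1))]. *)
Lemma polynomial_le_expR n : exists2 C : R, 0 < C &
  forall s, 0 <= s -> (1 + s) ^+ n <= C * expR (s / 4).
Proof.
pose k : R := n.+1%:R; have k1 : 1 <= k by rewrite ler1n.
exists ((4 * k) ^+ n.+1) => [|s s0]; first by rewrite exprn_gt0//; lra.
have H : 1 + s <= 4 * k * expR (s / (4 * k)).
  apply: (@le_trans _ _ (4 * k * (1 + s / (4 * k)))).
    have -> : 4 * k * (1 + s / (4 * k)) = 4 * k + s by field; lra.
    lra.
  by rewrite ler_pM2l ?expR_ge1Dx//; lra.
apply: (@le_trans _ _ ((1 + s) ^+ n.+1)).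
  by rewrite ler_weXn2l//; lra.
apply: (le_trans (lerXn2r _ _ _ H)); rewrite ?nnegrE; [lra| |].
  by rewrite mulr_ge0 ?expR_ge0//; lra.
rewrite exprMn -expRM_natl.
suff -> : n.+1%:R * (s / (4 * k)) = s / 4 by [].
by rewrite -/k; field; lra.
Qed.

(** Half of the exponent absorbs the polynomial; what is left is a Gaussian whose
integral does not depend on its centre, hence the uniformity in [x]. *)
Lemma gauss_moment_le n : exists2 C : R, 0 < C & forall x,
  (\int[leb]_y ((1 + enorm (vsub x y) ^+ 2) ^+ n *
     expR (- (enorm (vsub x y) ^+ 2 / 2)))%:E <= C%:E)%E.
Proof.
have [C C0 HC] := polynomial_le_expR n.
exists (C * Num.sqrt (pi / 4^-1) ^+ p).
  by rewrite mulr_gt0// exprn_gt0// sqrtr_gt0 divr_gt0// pi_gt0.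
move=> x; rewrite EFinM -(integral_gauss_vec x)// -ge0_integralZl_EFin ?(ltW C0)//; last first.
- apply/measurable_EFinP.
  exact: (measurable_comp_sqdist _ (measurable_gauss_fun 4^-1)).
apply: ge0_le_integral => //.
- by move=> y _; rewrite lee_fin mulr_ge0 ?expR_ge0 ?exprn_ge0 ?addr_ge0 ?sqr_ge0.
- apply/measurable_EFinP.
  apply: (measurable_comp_sqdist (f := fun s => (1 + s) ^+ n * expR (- (s / 2)))).
  apply: measurable_funM; last exact: measurable_half_gauss.
  apply: (measurable_funX n).
  exact: measurable_funD.
- apply/measurable_EFinP; apply: measurable_funM => //.
  exact: (measurable_comp_sqdist _ (measurable_gauss_fun 4^-1)).
move=> y _; rewrite -EFinM lee_fin; set s := _ ^+ 2.
have s0 : 0 <= s by exact: sqr_ge0.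
apply: (le_trans (ler_wpM2r (expR_ge0 _) (HC _ s0))).
by rewrite -mulrA -expRD ler_pM2l// ler_expR; lra.
Qed.

(** Dually, [1 / (1 + s)^n] is at least a multiple of a Gaussian factor. *)
Lemma gauss_moment_ge n : exists2 c : R, 0 < c & forall x,
  (c%:E <= \int[leb]_y (((1 + enorm (vsub x y) ^+ 2) ^+ n)^-1 *
     expR (- (enorm (vsub x y) ^+ 2 / 2)))%:E)%E.
Proof.
have [C C0 HC] := polynomial_le_expR n.
exists (C^-1 * Num.sqrt (pi / 1) ^+ p).
  by rewrite mulr_gt0 ?invr_gt0// exprn_gt0// sqrtr_gt0 divr_gt0// pi_gt0.
have mS : measurable_fun setT (fun s : R => ((1 + s) ^+ n)^-1 * expR (- (s / 2))).
  apply: measurable_funM; last exact: measurable_half_gauss.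
  apply: (measurableT_comp measurable_invr).
  by apply: (measurable_funX n); exact: measurable_funD.
move=> x; rewrite EFinM -(integral_gauss_vec x)//.
rewrite -ge0_integralZl_EFin ?invr_ge0 ?(ltW C0)//; last first.
- apply/measurable_EFinP.
  exact: (measurable_comp_sqdist _ (measurable_gauss_fun 1)).
apply: ge0_le_integral => //.
- by move=> y _; rewrite -EFinM lee_fin mulr_ge0 ?expR_ge0// invr_ge0 ltW.
- apply/measurable_EFinP; apply: measurable_funM => //.
  exact: (measurable_comp_sqdist _ (measurable_gauss_fun 1)).
- by apply/measurable_EFinP; exact: (measurable_comp_sqdist _ mS).
move=> y _; rewrite -EFinM lee_fin; set s := _ ^+ 2.
have s0 : 0 <= s by exact: sqr_ge0.
have s1 : 0 < (1 + s) ^+ n by rewrite exprn_gt0//; lra.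
rewrite mulrC ler_pdivrMr// -mulrA ler_pdivlMl//.
apply: (le_trans (ler_wpM2r (expR_ge0 _) (HC _ s0))).
by rewrite -mulrA -expRD [leRHS]mulrC ler_pM2l// ler_expR; lra.
Qed.

End gaussian_moments.

(** * The prior density and the posterior moments *)

Section prior_weight.
Context {R : realType} {p : nat}.
Variable a : R.
Hypothesis a0 : 0 < a.
Implicit Types x y : vec R p.

Definition prior_weight x : R := (a + enorm x ^+ 2) `^ (- (p%:R / 2)).

Let ax0 x : 0 < a + enorm x ^+ 2.
Proof. by rewrite ltr_pwDl// sqr_ge0. Qed.

Lemma prior_weight_gt0 x : 0 < prior_weight x.
Proof. exact/powR_gt0. Qed.

Lemma measurable_prior_weight : measurable_fun setT prior_weight.
Proof.
exact: (measurableT_comp (measurable_powR _) (measurable_add_sqr_enorm a)).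
Qed.

Lemma prior_densityE x : prior_density a x = prior_weight x.
Proof.
rewrite /prior_density /prior_weight powRN div1r -[X in X `^ _]powR_inv1 ?(ltW (ax0 _))//.
by rewrite -powRrM mulN1r powRN.
Qed.

(** Peetre's inequality: [a + |x|^2 <= k (1 + s) (a + |y|^2)] with [k = 2 + 2 / a],
raised to the power [p / 2].  The larger exponent [p] keeps the polynomial
factor a natural power. *)
Lemma prior_weight_peetre : exists2 K : R, 0 < K & forall x y,
  prior_weight y <= K * (1 + enorm (vsub x y) ^+ 2) ^+ p * prior_weight x.
Proof.
have [b b0 ba] : exists2 b : R, 0 <= b & b * a = 2.
  by exists (2 / a); rewrite ?divr_ge0 ?(ltW a0)// divfK// gt_eqF.
pose k : R := 2 + b; have k2 : 2 <= k by rewrite lerDl.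
exists (k ^+ p) => [|x y]; first by rewrite exprn_gt0//; lra.
set s := _ ^+ 2; have s0 : 0 <= s by exact: sqr_ge0.
have H : a + enorm x ^+ 2 <= k * (1 + s) * (a + enorm y ^+ 2).
  have := sqr_enorm_le x y; rewrite -/s => H1; have y0 := sqr_ge0 (enorm y).
  have -> : k * (1 + s) * (a + enorm y ^+ 2) = 2 * (1 + s) * a +
     b * (1 + s) * enorm y ^+ 2 + 2 * (1 + s) * enorm y ^+ 2 + b * a * (1 + s).
    by rewrite /k; ring.
  have H2 : 0 <= b * (1 + s) * enorm y ^+ 2.
    by do 2 apply: mulr_ge0 => //; exact: addr_ge0.
  have H3 : 0 <= s * a by rewrite mulr_ge0// ltW.
  have H4 : 0 <= s * enorm y ^+ 2 by rewrite mulr_ge0.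
  have := ltW a0; rewrite ba; lra.
rewrite -exprMn /prior_weight !powRN ler_pdivlMr ?powR_gt0//.
rewrite mulrC ler_pdivrMr ?powR_gt0//.
have p0 : 0 <= p%:R / 2 :> R by rewrite divr_ge0.
have ks : 1 <= k * (1 + s) by nra.
apply: (le_trans (ge0_ler_powR p0 _ _ H)); rewrite ?nnegrE ?(ltW (ax0 _))//.
  by rewrite mulr_ge0 ?(ltW (ax0 _))//; lra.
rewrite powRM ?(ltW (ax0 _))//; last by lra.
rewrite ler_wpM2r ?powR_ge0// -powR_mulrn; last by lra.
by rewrite ler_powR// ler_pdivrMr// ler_peMr// ler1n.
Qed.

End prior_weight.

Section posterior_moments.
Context {R : realType} {p : nat}.
Variables (a : R) (u : perturbation (R := R) p).
Hypothesis a0 : 0 < a.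
Implicit Types x y : vec R p.
Local Notation leb := (@lebesgue_vec R p).
Local Notation W := (posterior_weight a u).

Let measurable_moment (f : R -> R) x : measurable_fun setT f ->
  measurable_fun setT (fun y => (f (enorm (vsub x y) ^+ 2) * W x y)%:E).
Proof.
move=> mf; apply/measurable_EFinP; apply: measurable_funM.
  exact: measurable_comp_sqdist.
exact: measurable_posterior_weight.
Qed.

Let measurable_1DX n : measurable_fun setT (fun s : R => (1 + s) ^+ n).
Proof. by apply: (measurable_funX n); exact: measurable_funD. Qed.

Let measurable_1DXV n : measurable_fun setT (fun s : R => ((1 + s) ^+ n)^-1).
Proof. exact: (measurableT_comp measurable_invr (measurable_1DX n)). Qed.

Lemma posterior_weightE x y : W x y =
  expR (- (enorm (vsub x y) ^+ 2 / 2)) * u y * prior_weight a y.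
Proof. by []. Qed.

(** By Peetre's inequality the weight at [x] is [prior_weight x] times a Gaussian
around [x], up to a factor [(1 + s)^p] which the moment order absorbs. *)
Lemma posterior_moment_le n : exists2 C : R, 0 < C & forall x,
  (\int[leb]_y ((1 + enorm (vsub x y) ^+ 2) ^+ n * W x y)%:E
   <= (C * prior_weight a x)%:E)%E.
Proof.
have [C C0 HC] := @gauss_moment_le R p (n + p).
have [K K0 HK] := prior_weight_peetre (p := p) a0.
have [c c1 cu] := perturbation_bounded u.
have c0 : 0 < c by lra.
exists (c * K * C) => [|x]; first by rewrite !mulr_gt0.
have w0 := prior_weight_gt0 (p := p) a0.
have cKw0 : 0 <= c * K * prior_weight a x by rewrite !mulr_ge0// ltW.
rewrite mulrAC EFinM.
apply: (le_trans _ (lee_wpmul2l _ (HC x))); last by rewrite lee_fin.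
have mE : measurable_fun setT (fun y => ((1 + enorm (vsub x y) ^+ 2) ^+ (n + p) *
    expR (- (enorm (vsub x y) ^+ 2 / 2)))%:E).
  apply/measurable_EFinP; apply: (measurable_comp_sqdist
    (f := fun s => (1 + s) ^+ (n + p) * expR (- (s / 2)))).
  by apply: measurable_funM => //; exact: measurable_half_gauss.
rewrite -ge0_integralZl_EFin//; last first.
  by move=> y _; rewrite lee_fin mulr_ge0 ?expR_ge0 ?exprn_ge0 ?addr_ge0 ?sqr_ge0.
apply: ge0_le_integral => //.
- move=> y _; rewrite lee_fin mulr_ge0 ?posterior_weight_ge0//.
  by rewrite exprn_ge0// addr_ge0 ?sqr_ge0.
- exact: (measurable_moment (f := fun s => (1 + s) ^+ n)).
- exact: emeasurable_funM.
move=> y _; rewrite -EFinM lee_fin posterior_weightE.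
have := HK x y; set s := _ ^+ 2 => Hs; set e := expR _.
have s0 : 0 <= s by exact: sqr_ge0.
have [/andP[_ uc]] := (cu y, perturbation_ge0 u y); rewrite -/(u y) => u0.
rewrite [leRHS](_ : _ = (1 + s) ^+ n * (e * c * (K * (1 + s) ^+ p * prior_weight a x))).
  rewrite ler_wpM2l ?exprn_ge0 ?addr_ge0//.
  apply: ler_pM => //; rewrite ?mulr_ge0 ?expR_ge0 ?(ltW (w0 _))//.
  by rewrite ler_wpM2l ?expR_ge0// ltW.
by rewrite exprD; ring.
Qed.

Lemma posterior_moment_ge n : exists2 c : R, 0 < c & forall x,
  ((c * prior_weight a x)%:E <=
   \int[leb]_y (((1 + enorm (vsub x y) ^+ 2) ^+ n)^-1 * W x y)%:E)%E.
Proof.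
have [C C0 HC] := @gauss_moment_ge R p (n + p).
have [K K0 HK] := prior_weight_peetre (p := p) a0.
have [c c1 cu] := perturbation_bounded u.
have c0 : 0 < c by lra.
exists (c^-1 * K^-1 * C) => [|x]; first by rewrite !mulr_gt0 ?invr_gt0.
have w0 := prior_weight_gt0 (p := p) a0.
have cKw0 : 0 <= c^-1 * K^-1 * prior_weight a x by rewrite !mulr_ge0 ?invr_ge0// ltW.
rewrite mulrAC EFinM.
apply: (le_trans (lee_wpmul2l _ (HC x))); first by rewrite lee_fin.
have mE : measurable_fun setT (fun y => (((1 + enorm (vsub x y) ^+ 2) ^+ (n + p))^-1 *
    expR (- (enorm (vsub x y) ^+ 2 / 2)))%:E).
  apply/measurable_EFinP; apply: (measurable_comp_sqdist
    (f := fun s => ((1 + s) ^+ (n + p))^-1 * expR (- (s / 2)))).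
  by apply: measurable_funM => //; exact: measurable_half_gauss.
have pos y : 0 < 1 + enorm (vsub x y) ^+ 2 by rewrite ltr_pwDl// sqr_ge0.
rewrite -ge0_integralZl_EFin//; last first.
  by move=> y _; rewrite lee_fin mulr_ge0 ?expR_ge0// invr_ge0 exprn_ge0// ltW.
apply: ge0_le_integral => //.
- move=> y _; rewrite -EFinM lee_fin; apply: mulr_ge0 => //.
  by rewrite mulr_ge0 ?expR_ge0// invr_ge0 exprn_ge0// ltW.
- exact: emeasurable_funM.
- exact: (measurable_moment (f := fun s => ((1 + s) ^+ n)^-1)).
move=> y _; rewrite -EFinM lee_fin posterior_weightE.
have := HK y x; rewrite (enorm_vsubC y x).
have := pos y; set s := _ ^+ 2 => s1 Hs; set e := expR _.
have [/andP[uc _]] := (cu y, perturbation_ge0 u y); rewrite -/(u y) => u0.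
rewrite [leLHS](_ : _ = ((1 + s) ^+ n)^-1 * (e * c^-1 * (prior_weight a x / (K * (1 + s) ^+ p)))).
  rewrite ler_wpM2l ?invr_ge0 ?exprn_ge0 ?(ltW s1)//.
  apply: ler_pM => //; rewrite ?mulr_ge0 ?invr_ge0 ?mulr_ge0 ?expR_ge0 ?exprn_ge0
    ?(ltW s1) ?(ltW (w0 _)) ?(ltW c0) ?(ltW K0)//.
    by rewrite ler_wpM2l ?expR_ge0// ltW.
  by rewrite ler_pdivrMr ?mulr_gt0 ?exprn_gt0// mulrC.
by rewrite exprD !invfM; ring.
Qed.

End posterior_moments.

Section prior_tail.
Context {R : realType} {p : nat}.
Implicit Types y : vec R p.
Local Notation leb := (@lebesgue_vec R p).

(** The integrable function which dominates the errors in Blyth's method. *)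
Definition prior_tail (a : R) y : R :=
  (Num.sqrt (1 + enorm y ^+ 2))^-1 * prior_weight a y.

Lemma prior_tail_ge0 a y : 0 <= prior_tail a y.
Proof. by rewrite mulr_ge0 ?invr_ge0 ?sqrtr_ge0 ?powR_ge0. Qed.

Lemma measurable_prior_tail a : measurable_fun setT (prior_tail a).
Proof.
apply: measurable_funM; last exact: measurable_prior_weight.
apply: (measurableT_comp measurable_invr).
apply: (measurableT_comp (f := Num.sqrt : R -> R)); last exact: measurable_add_sqr_enorm.
by apply: continuous_measurable_fun; exact: sqrt_continuous.
Qed.

(** The tail has order [|y|^-(p + 1)].  Since [1 + |y_i|] is [O(sqrt (1 + |y|^2))]
for each [i], it is dominated by the product of the [p] functions
[(1 + |y_i|)^-(1 + 1/p)], each of them integrable on the line. *)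
Lemma integral_prior_tail_lty (a : R) : 0 < a -> (0 < p)%N ->
  (\int[leb]_y (prior_tail a y)%:E < +oo)%E.
Proof.
move=> a0 p0.
have pR0 : 0 < p%:R :> R by rewrite ltr0n.
(* (1 + |y|^2)^- sg is the share of one coordinate: p sg = (p + 1) / 2. *)
pose sg : R := (1 + p%:R^-1) / 2.
have sg0 : 0 < sg by rewrite divr_gt0// addr_gt0// invr_gt0.
pose al : R := Num.min a 1.
have al0 : 0 < al by rewrite lt_min a0 ltr01.
pose I : \bar R := (\int[@lebesgue_measure R]_t ((1 + `|t|) `^ (- (1 + p%:R^-1)))%:E)%E.
have Ioo : (I < +oo)%E by apply: integral_1Dabs_powRN_lty; rewrite invr_gt0.
have I0 : (0 <= I)%E by apply: integral_ge0 => t _; rewrite lee_fin powR_ge0.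
pose C : R := al `^ (- (p%:R / 2)) * (2 `^ sg) ^+ p.
have mk : measurable_fun setT (fun t : R => (1 + `|t|) `^ (- (1 + p%:R^-1))).
  exact: continuous_measurable_fun (@continuous_1Dabs_powR R _).
have mprod : measurable_fun setT (fun y : vec R p =>
    \prod_(i < p) ((1 + `|tnth y i|) `^ (- (1 + p%:R^-1)))).
  exact: (measurable_prod_tnth (f := fun i t => (1 + `|t|) `^ (- (1 + p%:R^-1)))).
have sq1 y : 0 < 1 + enorm y ^+ 2 by rewrite ltr_pwDl// sqr_ge0.
apply: (@le_lt_trans _ _ (C%:E * \int[leb]_y
    (\prod_(i < p) ((1 + `|tnth y i|) `^ (- (1 + p%:R^-1))))%:E)%E); last first.
  rewrite (integral_lebesgue_vec_prod
    (f := fun i t => (1 + `|t|) `^ (- (1 + p%:R^-1))))//.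
  rewrite -/I -(@fineK _ I) ?ge0_fin_numE//.
  by rewrite -(big_morph EFin EFinM erefl) -EFinM ltry.
rewrite -ge0_integralZl_EFin//; last 3 first.
- by move=> y _; rewrite lee_fin prodr_ge0// => i _; exact: powR_ge0.
- exact/measurable_EFinP.
- by rewrite mulr_ge0 ?powR_ge0// exprn_ge0// powR_ge0.
apply: ge0_le_integral => //.
- by move=> y _; rewrite lee_fin prior_tail_ge0.
- by apply/measurable_EFinP; exact: measurable_prior_tail.
- by apply: emeasurable_funM => //; exact/measurable_EFinP.
move=> y _; rewrite -EFinM lee_fin.
have y1 := sq1 y; set r := 1 + enorm y ^+ 2 in y1 *.
have Hw : prior_weight a y <= al `^ (- (p%:R / 2)) * r `^ (- (p%:R / 2)).
  rewrite -powRM ?(ltW al0) ?(ltW y1)// /prior_weight !powRN.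
  have alr : 0 < al * r by rewrite mulr_gt0.
  have ay : 0 < a + enorm y ^+ 2 by rewrite ltr_pwDl// sqr_ge0.
  rewrite lef_pV2 ?posrE ?powR_gt0// ge0_ler_powR// ?nnegrE ?(ltW alr) ?(ltW ay)//.
  by rewrite /r mulrDr mulr1 lerD ?ge_min ?lexx// ler_piMl ?sqr_ge0// ge_min lexx orbT.
have Hprod : (Num.sqrt r)^-1 * r `^ (- (p%:R / 2)) <= (2 `^ sg) ^+ p *
    \prod_(i < p) ((1 + `|tnth y i|) `^ (- (1 + p%:R^-1))).
  have -> : (Num.sqrt r)^-1 * r `^ (- (p%:R / 2)) = (r `^ (- sg)) ^+ p.
    rewrite -powR12_sqrt ?(ltW y1)// -powRN -powRD; last by rewrite (gt_eqF y1) implybT.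
    rewrite -powR_mulrn ?powR_ge0// -powRrM; congr (_ `^ _).
    by rewrite /sg; field; rewrite gt_eqF.
  rewrite -[in X in _ ^+ X <= _](card_ord p) -[in X in _ <= _ ^+ X * _](card_ord p).
  rewrite -!prodr_const -big_split/=; apply: ler_prod => i _.
  rewrite powR_ge0/= !powRN.
  have t0 : 0 < 1 + `|tnth y i| by rewrite ltr_pwDl.
  rewrite ler_pdivlMr ?powR_gt0// mulrC ler_pdivrMr ?powR_gt0//.
  rewrite -powRM ?(ltW y1)//.
  have -> : 1 + p%:R^-1 = 2 * sg by rewrite /sg; field; rewrite gt_eqF.
  rewrite powRrM powR_mulrn ?(ltW t0)//.
  rewrite ge0_ler_powR ?(ltW sg0) ?nnegrE ?sqr_ge0 ?mulr_ge0 ?(ltW y1)//.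
  have ti : `|tnth y i| ^+ 2 <= enorm y ^+ 2.
    rewrite real_normK ?num_real// sqr_enormE (bigD1 i)//= lerDl sumr_ge0// => j _.
    exact: sqr_ge0.
  have := sqr_ge0 (1 - `|tnth y i|); rewrite /r; lra.
apply: (@le_trans _ _ ((Num.sqrt r)^-1 * (al `^ (- (p%:R / 2)) * r `^ (- (p%:R / 2))))).
  by rewrite ler_wpM2l// invr_ge0 sqrtr_ge0.
by rewrite mulrCA /C -mulrA ler_wpM2l// powR_ge0.
Qed.

End prior_tail.

(** * The weights *)

Section cutoff.
Context {R : realType} {p : nat}.
Implicit Types (N : R) (x y : vec R p).

(** Close to 1 on the ball of radius [sqrt N], and square-integrable against the
prior.  The rational form, rather than a truncation, makes it comparable at
nearby points as well as slowly varying. *)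
Definition cutoff N y : R := N / (N + enorm y ^+ 2).

Let den_gt0 N y : 1 <= N -> 0 < N + enorm y ^+ 2.
Proof. by move=> N1; rewrite ltr_pwDl ?sqr_ge0//; lra. Qed.

Lemma cutoff_gt0 N y : 1 <= N -> 0 < cutoff N y.
Proof. by move=> N1; rewrite divr_gt0 ?den_gt0//; lra. Qed.

Lemma cutoff_le1 N y : 1 <= N -> cutoff N y <= 1.
Proof. by move=> N1; rewrite ler_pdivrMr ?den_gt0// mul1r lerDl sqr_ge0. Qed.

Lemma measurable_cutoff N : measurable_fun setT (cutoff N).
Proof.
apply: measurable_funM => //.
exact: (measurableT_comp measurable_invr (measurable_add_sqr_enorm N)).
Qed.

Lemma cutoff_mono N y : 1 <= N -> cutoff 1 y <= cutoff N y.
Proof.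
move=> N1; rewrite /cutoff ler_pdivrMr ?den_gt0// mulrAC ler_pdivlMr ?den_gt0//.
have := sqr_ge0 (enorm y) => y0; have : 0 <= (N - 1) * enorm y ^+ 2 by rewrite mulr_ge0// subr_ge0.
lra.
Qed.

(** The weight loses at most a polynomial factor between [x] and [y], so its
posterior second moment at [x] is at least a multiple of its square at [x]. *)
Lemma cutoff_peetre N x y : 1 <= N ->
  cutoff N x <= 2 * (1 + enorm (vsub x y) ^+ 2) * cutoff N y.
Proof.
move=> N1; rewrite /cutoff ler_pdivrMr ?den_gt0// mulrA mulrAC ler_pdivlMr ?den_gt0//.
have := sqr_enorm_le y x; rewrite (enorm_vsubC y x).
have := sqr_ge0 (enorm x); have := sqr_ge0 (enorm y); have := sqr_ge0 (enorm (vsub x y)).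
move: (enorm x ^+ 2) (enorm y ^+ 2) (enorm (vsub x y) ^+ 2) => X Y S S0 Y0 X0 H.
rewrite -!mulrA [leRHS](_ : _ = N * (2 * ((1 + S) * (N + X)))); last by ring.
rewrite ler_wpM2l//; first by lra.
have : 0 <= S * X by rewrite mulr_ge0.
have : 0 <= (N - 1) * S by rewrite mulr_ge0// subr_ge0.
lra.
Qed.

(** The weight varies on the scale of its distance to the origin, not on the unit
scale on which the posterior at [x] lives. *)
Lemma sqr_cutoffB_le N x y : 1 <= N ->
  (cutoff N y - cutoff N x) ^+ 2 <= 4 * enorm (vsub x y) ^+ 2 / (N + enorm x ^+ 2).
Proof.
move=> N1; have X1 := den_gt0 x N1; have Y1 := den_gt0 y N1.
have -> : cutoff N y - cutoff N x = N * (enorm x ^+ 2 - enorm y ^+ 2) /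
    ((N + enorm y ^+ 2) * (N + enorm x ^+ 2)).
  by rewrite /cutoff; field; rewrite !gt_eqF.
have := sqr_sub_sqr_enorm_le x y.
have := sqr_ge0 (enorm x); have := sqr_ge0 (enorm y); have := sqr_ge0 (enorm (vsub x y)).
move: X1 Y1.
move: (enorm x ^+ 2) (enorm y ^+ 2) (enorm (vsub x y) ^+ 2) => X Y S X1 Y1 S0 Y0 X0 H.
rewrite expr_div_n ler_pdivrMr ?exprn_gt0 ?mulr_gt0//.
rewrite [leRHS](_ : _ = 4 * S * ((N + Y) ^+ 2 * (N + X))); last by field; rewrite gt_eqF.
rewrite exprMn; apply: (le_trans (ler_wpM2l (sqr_ge0 N) H)).
rewrite [leLHS](_ : _ = 2 * S * (N ^+ 2 * (X + Y))); last by ring.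
rewrite [leRHS](_ : _ = 2 * S * (2 * ((N + Y) ^+ 2 * (N + X)))); last by ring.
rewrite ler_wpM2l//; first by rewrite mulr_ge0.
have N0 : 0 <= N by lra.
have h1 : 0 <= N * Y * X by rewrite !mulr_ge0.
have h2 : 0 <= Y ^+ 2 * X by rewrite !mulr_ge0 ?sqr_ge0.
have h3 : 0 <= N ^+ 2 * Y by rewrite !mulr_ge0.
have h4 : 0 <= N * Y ^+ 2 by rewrite !mulr_ge0.
have h5 : 0 <= N ^+ 2 * X by rewrite !mulr_ge0.
have h6 : 0 <= N ^+ 3 by rewrite exprn_ge0.
lra.
Qed.

(** [m^2 + X >= m sqrt (1 + X)]: part of the decay in [x] is traded for the
factor [1 / m]. *)
Lemma cutoff_den_le (m : R) x : 1 <= m ->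
  (m ^+ 2 + enorm x ^+ 2)^-1 <= m^-1 * (Num.sqrt (1 + enorm x ^+ 2))^-1.
Proof.
move=> m1; have x0 := sqr_ge0 (enorm x).
have s0 : 0 < 1 + enorm x ^+ 2 by rewrite ltr_pwDl.
have m2 : 1 <= m ^+ 2 by rewrite exprn_ege1.
rewrite -invfM lef_pV2 ?posrE ?mulr_gt0 ?sqrtr_gt0 ?ltr_pwDl//; [|lra..].
rewrite -ler_sqr ?nnegrE ?mulr_ge0 ?sqrtr_ge0 ?addr_ge0//; [|lra..].
rewrite exprMn sqr_sqrtr ?(ltW s0)//.
move: x0 {s0}; move: (enorm x ^+ 2) => X X0.
move: m2; move: (m ^+ 2) => N N1.
have : 0 <= N * X by rewrite mulr_ge0//; lra.
have : 0 <= N * (N - 1) by rewrite mulr_ge0//; lra.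
have := sqr_ge0 X; lra.
Qed.

End cutoff.

(** * Blyth's method *)

(** After expansion there remains the cross term
[2 D (h + k) (h - k) g], split by the arithmetic-geometric mean inequality with
parameter [lam].  On integration, the term [2 D k^2 g] vanishes for a centred
[g] and the term in [lam] is absorbed by [D^2 h^2]. *)
Lemma blyth_pointwise (R : realFieldType) (g h k D lam : R) : 0 < lam ->
  h ^+ 2 * g ^+ 2 + D ^+ 2 * h ^+ 2 <=
  h ^+ 2 * (g - D) ^+ 2 + 2 * D * k ^+ 2 * g +
  D ^+ 2 * (2 * lam) * (h ^+ 2 + k ^+ 2) + lam^-1 * ((h - k) ^+ 2 * g ^+ 2).
Proof.
move=> lam0; rewrite -subr_ge0 [X in 0 <= X](_ : _ =
    lam^-1 * (lam * D * (h + k) - (h - k) * g) ^+ 2 + lam * (D * (h - k)) ^+ 2).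
  by rewrite addr_ge0// mulr_ge0 ?sqr_ge0// ?invr_ge0 ltW.
by field; rewrite gt_eqF.
Qed.

Section blyth_local.
Context d (T : measurableType d) (R : realType).
Variable rho : {measure set T -> \bar R}.
Variables (G h : T -> R).
Hypotheses (mG : measurable_fun setT G) (mh : measurable_fun setT h).
Hypothesis rho_fin : (rho setT < +oo)%E.
Hypothesis intG2 : (\int[rho]_x (G x ^+ 2)%:E < +oo)%E.

Let integrable_dom (f : T -> R) (K : R) : measurable_fun setT f ->
  (forall x, `|f x| <= K * (1 + G x ^+ 2)) -> rho.-integrable setT (EFin \o f).
Proof.
move=> mf fK.
apply: (@le_integrable _ _ _ rho setT measurableT _
  (fun x => (K * (1 + G x ^+ 2))%:E)) => //.
- exact/measurable_EFinP.
- move=> x _ /=; rewrite lee_fin (le_trans (fK x))//; exact: ler_norm.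
have iG : rho.-integrable setT (fun x => (G x ^+ 2)%:E).
  apply/integrableP; split; first by apply/measurable_EFinP; exact: measurable_funX.
  by under eq_integral do rewrite gee0_abs ?lee_fin ?sqr_ge0//.
have i1 : rho.-integrable setT (fun x => (1 : R)%:E).
  apply/integrableP; split => //.
  by under eq_integral do rewrite abse1; rewrite integral_cst// mul1e.
by have := integrableZl measurableT K (integrableD measurableT i1 iG).
Qed.

Let EFin_Rintegral (f : T -> R) : rho.-integrable setT (EFin \o f) ->
  (\int[rho]_x (f x)%:E = (\int[rho]_x f x)%:E)%E.
Proof. by move=> intf; rewrite /Rintegral fineK// integrable_fin_num. Qed.

(** [|G| <= 1 + G^2], and constants are integrable for a finite measure. *)
Lemma integrable_of_sqr_lty : rho.-integrable setT (EFin \o G).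
Proof.
apply: (integrable_dom (K := 1)) => // x.
rewrite mul1r ler_norml; have := sqr_ge0 (G x - 1); have := sqr_ge0 (G x + 1); lra.
Qed.

Let integrable_sqrB (b : R) : rho.-integrable setT (EFin \o (fun x => (G x - b) ^+ 2)).
Proof.
apply: (integrable_dom (K := 2 + 2 * b ^+ 2)).
  by apply: (measurable_funX 2); exact: measurable_funB.
move=> x; rewrite ger0_norm ?sqr_ge0//.
have := sqr_ge0 (G x + b); have : 0 <= b ^+ 2 * G x ^+ 2 by rewrite mulr_ge0 ?sqr_ge0.
lra.
Qed.

(** For a centred [G], the second moment about [b] is the variance plus [b^2]. *)
Lemma centered_sqr_mean_le (b : R) : (\int[rho]_x (G x)%:E = 0)%E ->
  ((b ^+ 2)%:E * rho setT <= \int[rho]_x ((G x - b) ^+ 2)%:E)%E.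
Proof.
move=> G0; rewrite -integral_cst//.
have ic : rho.-integrable setT (EFin \o (fun x => b ^+ 2)).
  apply: (integrable_dom (K := b ^+ 2)) => // x.
  rewrite ger0_norm ?sqr_ge0//; have : 0 <= b ^+ 2 * G x ^+ 2 by rewrite mulr_ge0 ?sqr_ge0.
  lra.
have iL : rho.-integrable setT (EFin \o (fun x => 2 * b * G x)).
  exact: (integrableZl measurableT (2 * b) integrable_of_sqr_lty).
rewrite (EFin_Rintegral ic) (EFin_Rintegral (integrable_sqrB b)) lee_fin.
rewrite -[leRHS]addr0.
have -> : 0 = \int[rho]_x (2 * b * G x).
  by rewrite (RintegralZl _ _ integrable_of_sqr_lty)// /Rintegral G0/= mulr0.
rewrite -RintegralD//; apply: le_Rintegral => //.
  exact: (integrableD measurableT (integrable_sqrB b) iL).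
by move=> x _; have := sqr_ge0 (G x); lra.
Qed.

(** The loss of a centred [G] at 0, weighted by [h^2], can exceed its loss at
another value [D] only through the oscillation of [h] about the constant [k].
The hypothesis on [lam] says that [k^2] is not large compared with the
[rho]-average of [h^2]. *)
Lemma blyth_local (D k lam : R) : (\int[rho]_x (G x)%:E = 0)%E ->
  (forall x, 0 <= h x <= 1) -> 0 < lam ->
  ((2 * lam)%:E * \int[rho]_x (h x ^+ 2 + k ^+ 2)%:E <= \int[rho]_x (h x ^+ 2)%:E)%E ->
  (\int[rho]_x (h x ^+ 2 * G x ^+ 2)%:E <=
   \int[rho]_x (h x ^+ 2 * (G x - D) ^+ 2)%:E +
   lam^-1%:E * \int[rho]_x ((h x - k) ^+ 2 * G x ^+ 2)%:E)%E.
Proof.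
move=> G0 h01 lam0.
have h2 x : 0 <= h x ^+ 2 <= 1.
  by have /andP[? ?] := h01 x; rewrite sqr_ge0/= exprn_ile1.
have mh2 : measurable_fun setT (fun x => h x ^+ 2) by exact: (measurable_funX 2).
have mG2 : measurable_fun setT (fun x => G x ^+ 2) by exact: (measurable_funX 2).
have iH : rho.-integrable setT (EFin \o (fun x => h x ^+ 2)).
  apply: (integrable_dom (K := 1)) => // x; have /andP[? ?] := h2 x.
  by rewrite ger0_norm//; have := sqr_ge0 (G x); lra.
have iY : rho.-integrable setT (EFin \o (fun x => h x ^+ 2 + k ^+ 2)).
  apply: (integrable_dom (K := 1 + k ^+ 2)).
    exact: measurable_funD.
  move=> x; have /andP[? ?] := h2 x; have ? := sqr_ge0 k; have ? := sqr_ge0 (G x).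
  rewrite ger0_norm; last exact: addr_ge0.
  have : 0 <= (1 + k ^+ 2) * G x ^+ 2 by rewrite mulr_ge0//; lra.
  lra.
have iA : rho.-integrable setT (EFin \o (fun x => h x ^+ 2 * G x ^+ 2)).
  apply: (integrable_dom (K := 1)); first exact: measurable_funM.
  move=> x; have /andP[? ?] := h2 x; have ? := sqr_ge0 (G x).
  rewrite ger0_norm; last exact: mulr_ge0.
  have : h x ^+ 2 * G x ^+ 2 <= 1 * G x ^+ 2 by exact: ler_wpM2r.
  lra.
have iX : rho.-integrable setT (EFin \o (fun x => h x ^+ 2 * (G x - D) ^+ 2)).
  apply: (le_integrable _ _ _ (integrable_sqrB D)) => //.
    apply/measurable_EFinP; apply: measurable_funM => //.
    by apply: (measurable_funX 2); exact: measurable_funB.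
  move=> x _ /=; have /andP[? ?] := h2 x; have gD := sqr_ge0 (G x - D).
  rewrite lee_fin !ger0_norm//; last exact: mulr_ge0.
  exact: ler_piMl.
have iZ : rho.-integrable setT (EFin \o (fun x => (h x - k) ^+ 2 * G x ^+ 2)).
  apply: (integrable_dom (K := 2 + 2 * k ^+ 2)).
    apply: measurable_funM => //.
    by apply: (measurable_funX 2); exact: measurable_funB.
  move=> x; have /andP[? ?] := h2 x; have ? := sqr_ge0 (G x); have ? := sqr_ge0 k.
  rewrite ger0_norm; last by apply: mulr_ge0 => //; exact: sqr_ge0.
  have Hk : (h x - k) ^+ 2 <= 2 + 2 * k ^+ 2 by have := sqr_ge0 (h x + k); lra.
  have := ler_wpM2r (sqr_ge0 (G x)) Hk; lra.
rewrite !EFin_Rintegral// -!EFinM -EFinD !lee_fin => HH.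
pose mu := lam^-1; have lm : lam * mu = 1 by rewrite mulfV// gt_eqF.
have mu0 : 0 < mu by rewrite invr_gt0.
have iL : rho.-integrable setT (EFin \o (fun x => 2 * D * k ^+ 2 * G x)).
  exact: (integrableZl measurableT (2 * D * k ^+ 2) integrable_of_sqr_lty).
have iH' : rho.-integrable setT (EFin \o (fun x => D ^+ 2 * h x ^+ 2)).
  exact: (integrableZl measurableT (D ^+ 2) iH).
have iY' : rho.-integrable setT (EFin \o (fun x => D ^+ 2 * (2 * lam) * (h x ^+ 2 + k ^+ 2))).
  exact: (integrableZl measurableT (D ^+ 2 * (2 * lam)) iY).
have iZ' : rho.-integrable setT (EFin \o (fun x => mu * ((h x - k) ^+ 2 * G x ^+ 2))).
  exact: (integrableZl measurableT mu iZ).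
have iXL := integrableD measurableT iX iL.
have iXLY := integrableD measurableT iXL iY'.
have iXLYZ := integrableD measurableT iXLY iZ'.
have : \int[rho]_x (h x ^+ 2 * G x ^+ 2 + D ^+ 2 * h x ^+ 2) <=
  \int[rho]_x (h x ^+ 2 * (G x - D) ^+ 2 + 2 * D * k ^+ 2 * G x +
    D ^+ 2 * (2 * lam) * (h x ^+ 2 + k ^+ 2) + mu * ((h x - k) ^+ 2 * G x ^+ 2)).
  apply: le_Rintegral => //; first exact: (integrableD measurableT iA iH').
  by move=> x _; exact: blyth_pointwise.
rewrite (RintegralD _ iA iH')// (RintegralD _ iXLY iZ')// (RintegralD _ iXL iY')//.
rewrite (RintegralD _ iX iL)// !RintegralZl//; last exact: integrable_of_sqr_lty.
rewrite [X in _ + _ * X + _ + _](_ : _ = 0); last by rewrite /Rintegral G0.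
have := ler_wpM2l (sqr_ge0 D) HH; rewrite mulr0 -/mu; lra.
Qed.

End blyth_local.

Section blyth_method.
Context d (T : measurableType d) (R : realType).

(** If the weighted risks of [r0] and [r1] differ by at most [C / m], then so does
the integral of [h 1 ^ 2 (r0 - r1)], whose weight does not depend on [m]: it
is zero. *)
Lemma blyth_null_gain (nu : {measure set T -> \bar R}) (r0 r1 : T -> \bar R)
    (h : R -> T -> R) (K C : R) :
  measurable_fun setT r0 -> measurable_fun setT r1 ->
  (forall y, 0 <= r1 y)%E -> (forall y, r1 y <= r0 y)%E ->
  (forall y, r0 y <= K%:E)%E -> 0 < K -> 0 < C ->
  (forall m, measurable_fun setT (h m)) -> (forall y, 0 < h 1 y) ->
  (forall m y, 1 <= m -> h 1 y <= h m y) ->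
  (forall m, 1 <= m -> (\int[nu]_y (h m y ^+ 2)%:E < +oo)%E) ->
  (forall m, 1 <= m -> (\int[nu]_y ((h m y ^+ 2)%:E * r0 y) <=
     \int[nu]_y ((h m y ^+ 2)%:E * r1 y) + (C / m)%:E)%E) ->
  nu [set y | (r1 y < r0 y)%E] = 0%E.
Proof.
move=> mr0 mr1 r1_ge0 r10 r0K K0 C0 mh h1_gt0 h1_le hfin HC.
have r1fin y : r1 y \is a fin_num.
  by rewrite ge0_fin_numE// (le_lt_trans (r10 y))// (le_lt_trans (r0K y)) ?ltry.
pose gain y := (r0 y - r1 y)%E.
have mgain : measurable_fun setT gain by exact: emeasurable_funB.
have gain_ge0 y : (0 <= gain y)%E by rewrite /gain sube_ge0 ?r1fin.
have mh2 m : measurable_fun setT (fun y => (h m y ^+ 2)%:E).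
  by apply/measurable_EFinP; exact: (measurable_funX 2).
have h2_ge0 m y : (0 <= (h m y ^+ 2)%:E)%E by rewrite lee_fin sqr_ge0.
have gain_le m : 1 <= m ->
    (\int[nu]_y ((h 1 y ^+ 2)%:E * gain y) <= (C / m)%:E)%E.
  move=> m1.
  apply: (@le_trans _ _ (\int[nu]_y ((h m y ^+ 2)%:E * gain y))%E).
    apply: ge0_le_integral => //.
    - by move=> y _; rewrite mule_ge0.
    - exact: emeasurable_funM.
    - exact: emeasurable_funM.
    move=> y _; apply: lee_wpmul2r => //; rewrite lee_fin.
    have h0 := ltW (h1_gt0 y); have hm := h1_le m y m1.
    by apply: lerXn2r; rewrite ?nnegrE// (le_trans h0).
  have := HC m m1.
  have -> : (\int[nu]_y ((h m y ^+ 2)%:E * r0 y) =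
     \int[nu]_y ((h m y ^+ 2)%:E * r1 y) + \int[nu]_y ((h m y ^+ 2)%:E * gain y))%E.
    rewrite -ge0_integralD//; last 4 first.
    - by move=> y _; rewrite mule_ge0.
    - exact: emeasurable_funM.
    - by move=> y _; rewrite mule_ge0.
    - exact: emeasurable_funM.
    apply: eq_integral => y _; rewrite -ge0_muleDr//; congr (_ * _)%E.
    by rewrite /gain addeC subeK.
  (* Both weighted risks are finite, so the one of r1 cancels. *)
  rewrite leeD2lE// ge0_fin_numE; last by apply: integral_ge0 => y _; rewrite mule_ge0.
  apply: (@le_lt_trans _ _ (K%:E * \int[nu]_y (h m y ^+ 2)%:E)%E); last first.
    by rewrite lte_mul_pinfty// ?hfin// lee_fin ltW.
  rewrite -ge0_integralZl_EFin// ?(ltW K0)//.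
  apply: ge0_le_integral => //.
  - by move=> y _; rewrite mule_ge0.
  - exact: emeasurable_funM.
  - exact: emeasurable_funM.
  move=> y _; rewrite muleC; apply: lee_wpmul2r => //.
  exact: le_trans (r10 y) (r0K y).
have gain0 : (\int[nu]_y ((h 1 y ^+ 2)%:E * gain y) = 0)%E.
  apply/eqP; rewrite eq_le; apply/andP; split; last first.
    by apply: integral_ge0 => y _; rewrite mule_ge0.
  apply/lee_addgt0Pr => e e0; rewrite add0e.
  have Ce : 0 <= C / e by rewrite divr_ge0 ?ltW.
  (* m = 1 + C / e is at least 1, and C / m <= e. *)
  apply: (le_trans (gain_le (1 + C / e) _)); first by rewrite lerDl.
  rewrite lee_fin ler_pdivrMr; last by rewrite ltr_pwDl.
  by rewrite mulrDr mulr1 mulrCA divff ?gt_eqF// mulr1 lerDr ltW.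
have mset : measurable [set y | (r1 y < r0 y)%E].
  by rewrite -[X in measurable X]setTI; exact: measurable_lte.
apply: measure_negligible => //.
have : ae_eq nu setT (fun y => (h 1 y ^+ 2)%:E * gain y)%E (cst 0%E).
  apply/ae_eq_integral_abs => //; first exact: emeasurable_funM.
  by under eq_integral do rewrite gee0_abs ?mule_ge0//.
apply: negligibleS => y /= r10y /(_ I) /eqP; rewrite mule_eq0 => /orP[].
  by rewrite eqe expf_eq0/= gt_eqF.
by rewrite gt_eqF// sube_gt0.
Qed.

End blyth_method.

(** * The formal Bayes estimator *)

Section bayes.
Context {R : realType} {p q : nat}.
Variables (a d M : R) (u : perturbation (R := R) p) (phi : vec R p -> vec R q).
Hypotheses (a0 : 0 < a) (d0 : 0 < d) (M0 : 0 < M).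
Hypothesis mphi : measurable_fun setT phi.
Hypothesis phiM : forall x y,
  enorm (vsub (phi x) (phi y)) ^+ 2 <= M * (enorm (vsub x y) ^+ 2 + d).
Local Notation leb := (@lebesgue_vec R p).
Local Notation W := (posterior_weight a u).
Local Notation w := (prior_weight a).
Local Notation fb := (formal_bayes a u phi).
Implicit Types x y : vec R p.

(** The posterior at [x] before normalization.  Blyth's inequality is homogeneous
in the measure, so that normalizing is needed only to identify the centring
constant. *)
Let rho x : {measure set (vec R p) -> \bar R} :=
  density leb (measurable_posterior_weight a u x) (posterior_weight_ge0 a u x).

Let w0 x : 0 < w x. Proof. exact: prior_weight_gt0. Qed.

Let measurable_W2 : measurable_fun setT (fun z : vec R p * vec R p => W z.1 z.2).
Proof.
apply: measurable_funM; first apply: measurable_funM.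
- exact: (measurableT_comp measurable_half_gauss measurable_sqr_enorm_vsub2).
- exact: (measurableT_comp (measurable_perturbation u) measurable_snd).
- apply: (measurableT_comp (measurable_powR _)).
  exact: (measurableT_comp (measurable_add_sqr_enorm a) measurable_snd).
Qed.

Lemma integral_rho x (f : vec R p -> \bar R) : measurable_fun setT f ->
  (forall y, 0 <= f y)%E -> (\int[rho x]_y f y = \int[leb]_y ((W x y)%:E * f y))%E.
Proof. exact: ge0_integral_density. Qed.

Lemma integral_rho_EFin x (f : vec R p -> R) : measurable_fun setT f ->
  (forall y, 0 <= f y) ->
  (\int[rho x]_y (f y)%:E = \int[leb]_y (f y * W x y)%:E)%E.
Proof.
move=> mf f0; rewrite integral_rho//; last exact/measurable_EFinP.
by apply: eq_integral => y _; rewrite -EFinM mulrC.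
Qed.

Let measurable_1DX n x : measurable_fun setT (fun y => (1 + enorm (vsub x y) ^+ 2) ^+ n).
Proof.
apply: (measurable_comp_sqdist (f := fun s => (1 + s) ^+ n)).
by apply: (measurable_funX n); exact: measurable_funD.
Qed.

Lemma rho_moment n : exists2 C : R, 0 < C & forall x,
  (\int[rho x]_y ((1 + enorm (vsub x y) ^+ 2) ^+ n)%:E <= (C * w x)%:E)%E.
Proof.
have [C C0 HC] := posterior_moment_le u a0 n; exists C => // x.
by rewrite integral_rho_EFin// => y; rewrite exprn_ge0// addr_ge0// sqr_ge0.
Qed.

Lemma rho_dominated n : exists2 C : R, 0 < C & forall x (B : R) (f : vec R p -> R),
  measurable_fun setT f -> (forall y, 0 <= f y) ->
  (forall y, f y <= B * (1 + enorm (vsub x y) ^+ 2) ^+ n) -> 0 <= B ->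
  (\int[rho x]_y (f y)%:E <= (B * (C * w x))%:E)%E.
Proof.
have [C C0 HC] := rho_moment n; exists C => // x B f mf f0 fB B0.
apply: (@le_trans _ _ (B%:E * \int[rho x]_y ((1 + enorm (vsub x y) ^+ 2) ^+ n)%:E)%E).
  rewrite -ge0_integralZl_EFin//; last 2 first.
  - by move=> y _; rewrite lee_fin exprn_ge0// addr_ge0// sqr_ge0.
  - exact/measurable_EFinP.
  apply: ge0_le_integral => //.
  - by move=> y _; rewrite lee_fin.
  - exact/measurable_EFinP.
  - by apply: emeasurable_funM => //; exact/measurable_EFinP.
  - by move=> y _; rewrite -EFinM lee_fin.
by rewrite EFinM lee_wpmul2l ?lee_fin.
Qed.

Lemma rhoT_le : exists2 C : R, 0 < C & forall x, (rho x setT <= (C * w x)%:E)%E.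
Proof.
have [C C0 HC] := rho_moment 0; exists C => // x.
apply: le_trans (HC x); under eq_integral do rewrite expr0.
by rewrite integral_cst// mul1e.
Qed.

Lemma rhoT_lty x : (rho x setT < +oo)%E.
Proof. by have [C _ /(_ x) H] := rhoT_le; exact: le_lt_trans H (ltry _). Qed.

Lemma rhoT_ge : exists2 c : R, 0 < c & forall x, ((c * w x)%:E <= rho x setT)%E.
Proof.
have [C C0 HC] := posterior_moment_ge u a0 0; exists C => // x.
apply: (le_trans (HC x)).
by under eq_integral do rewrite expr0 invr1 mul1r.
Qed.

Lemma rhoT_gt0 x : (0 < rho x setT)%E.
Proof.
have [c c0 /(_ x)] := rhoT_ge; apply: lt_le_trans.
by rewrite lte_fin mulr_gt0.
Qed.

Section coordinate.
Variable i : 'I_q.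
Local Notation g := (fun y => tnth (phi y) i).
Local Notation mu := (fun x => tnth (fb x) i).

Let mg : measurable_fun setT g.
Proof. exact: (measurableT_comp (measurable_tnth i) mphi). Qed.

Let gM x y : (g x - g y) ^+ 2 <= M * (1 + d) * (1 + enorm (vsub x y) ^+ 2).
Proof.
apply: (@le_trans _ _ (enorm (vsub (phi x) (phi y)) ^+ 2)).
  rewrite sqr_enorm_vsubE (bigD1 i)//= lerDl sumr_ge0// => j _; exact: sqr_ge0.
apply: (le_trans (phiM x y)); rewrite -mulrA ler_wpM2l ?(ltW M0)//.
have : 0 <= d * enorm (vsub x y) ^+ 2 by rewrite mulr_ge0 ?sqr_ge0 ?(ltW d0).
lra.
Qed.

Let mgB (b : R) : measurable_fun setT (fun y => (g y - b) ^+ 2).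
Proof. by apply: (measurable_funX 2); exact: measurable_funB. Qed.

Lemma sqr_shift_lty x (b : R) :
  (\int[rho x]_y ((g y - b) ^+ 2)%:E < +oo)%E.
Proof.
have [C C0 HC] := rho_dominated 1.
apply: (le_lt_trans (HC x (2 * (M * (1 + d)) + 2 * (g x - b) ^+ 2) _ (mgB b) _ _ _));
  rewrite ?ltry//.
- by move=> y; exact: sqr_ge0.
- move=> y; rewrite expr1.
  have := gM x y; have := sqr_ge0 (g x - b).
  have : 0 <= (g x - b) ^+ 2 * enorm (vsub x y) ^+ 2 by rewrite mulr_ge0 ?sqr_ge0.
  have := sqr_ge0 ((g x - g y) + (g x - b)); lra.
- by rewrite addr_ge0// mulr_ge0 ?sqr_ge0// mulr_ge0 ?(ltW M0)// addr_ge0// ltW.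
Qed.

Let integrableB x (b : R) : (rho x).-integrable setT (EFin \o (fun y => g y - b)).
Proof.
by apply: integrable_of_sqr_lty; [exact: measurable_funB|exact: rhoT_lty|exact: sqr_shift_lty].
Qed.

Let integrable_g x : (rho x).-integrable setT (EFin \o g).
Proof.
have := integrableB x 0; congr (integrable _ _ _).
by apply/funext => y /=; rewrite subr0.
Qed.

Lemma formal_bayesE x :
  mu x = fine ((fine (rho x setT))^-1%:E * \int[rho x]_y (g y)%:E)%E.
Proof.
rewrite /formal_bayes tnth_mktuple /Rintegral; congr fine.
by rewrite (integral_mnormalize _ (rhoT_gt0 x) (rhoT_lty x)).
Qed.

(** Rescaling the measure does not move its mean: the mean of the normalized
posterior also centres [g] for [rho x]. *)
Lemma integral_centered x : (\int[rho x]_y (g y - mu x)%:E = 0)%E.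
Proof.
have Zfin : rho x setT \is a fin_num by rewrite ge0_fin_numE// rhoT_lty.
have Z0 : 0 < fine (rho x setT) by rewrite fine_gt0// rhoT_gt0 rhoT_lty.
have gfin : (\int[rho x]_y (g y)%:E)%E \is a fin_num.
  exact: (integrable_fin_num measurableT (integrable_g x)).
have ic : (rho x).-integrable setT (EFin \o (fun=> mu x)).
  apply/integrableP; split; first exact/measurable_EFinP.
  by rewrite integral_cst// lte_mul_pinfty// rhoT_lty.
rewrite (integralB_EFin measurableT (integrable_g x) ic) integral_cst//.
rewrite formal_bayesE; move: gfin Zfin Z0.
case: (\int[rho x]_y (g y)%:E)%E => // I _; case: (rho x setT) => // Z _ /= Z0.
by rewrite -?EFinM -?EFinB mulrAC mulVf ?gt_eqF// mul1r subrr.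
Qed.

(** Tonelli's theorem applies to the positive and negative parts separately. *)
Lemma measurable_formal_bayes_coord : measurable_fun setT mu.
Proof.
rewrite (_ : mu = fun x => fine ((fine (rho x setT))^-1%:E *
  (\int[leb]_y ((W x y)%:E * (EFin \o g)^\+ y) -
   \int[leb]_y ((W x y)%:E * (EFin \o g)^\- y)))%E); last first.
  apply/funext => x; rewrite formal_bayesE; congr (fine (_ * _)).
  rewrite integralE !integral_rho//.
  - by apply: measurable_funeneg; exact/measurable_EFinP.
  - by apply: measurable_funepos; exact/measurable_EFinP.
have mT (f : vec R p -> \bar R) : measurable_fun setT f -> (forall y, 0 <= f y)%E ->
    measurable_fun setT (fun x => \int[leb]_y ((W x y)%:E * f y))%E.
  move=> mf f0.
  apply: (measurable_fun_fubini_tonelli_F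
    (fun z : vec R p * vec R p => ((W z.1 z.2)%:E * f z.2)%E)).
  - apply: emeasurable_funM; first exact/measurable_EFinP.
    exact: (measurableT_comp mf measurable_snd).
  - by move=> z; rewrite mule_ge0// lee_fin posterior_weight_ge0.
apply: (measurableT_comp (fine_measurable measurableT)).
apply: emeasurable_funM; last apply: emeasurable_funB.
- apply/measurable_EFinP; apply: (measurableT_comp measurable_invr).
  apply: (measurableT_comp (fine_measurable measurableT)).
  rewrite (_ : (fun x => _) = fun x => (\int[leb]_y ((W x y)%:E * 1))%E); last first.
    by apply/funext => x; apply: eq_integral => y _; rewrite mule1.
  exact: mT.
- by apply: mT => //; apply: measurable_funepos; exact/measurable_EFinP.
- by apply: mT => //; apply: measurable_funeneg; exact/measurable_EFinP.
Qed.

(** By the growth condition the second moment of [g] about [g x] is of the order of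
the mass of [rho x], and it exceeds [(g x - mu x)^2] times that mass.  Hence
[mu x] is within bounded distance of [g x]. *)
Lemma sqr_deviation_le : exists2 C : R, 0 < C & forall x y,
  (g y - mu x) ^+ 2 <= C * (1 + enorm (vsub x y) ^+ 2).
Proof.
have [C1 C10 H1] := rho_dominated 1; have [c c0 Hc] := rhoT_ge.
pose K : R := M * (1 + d); have K0 : 0 < K by rewrite mulr_gt0// addr_gt0.
exists (2 * K + 2 * (K * C1 / c)).
  have L0 : 0 < K * C1 / c by rewrite divr_gt0// mulr_gt0.
  by rewrite addr_gt0// mulr_gt0.
move=> x y; pose b := g x - mu x.
have mG : measurable_fun setT (fun y => g y - mu x) by exact: measurable_funB.
have Hb : b ^+ 2 <= K * C1 / c.
  have := centered_sqr_mean_le mG (rhoT_lty x) (sqr_shift_lty x (mu x)) b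
    (integral_centered x).
  under eq_integral.
    move=> z _; rewrite (_ : g z - mu x - b = g z - g x); last by rewrite /b; ring.
    over.
  move=> /le_trans /(_ (H1 x K _ (mgB (g x)) _ _ _)) H.
  have {}H : (((b ^+ 2)%:E * rho x setT) <= (K * (C1 * w x))%:E)%E.
    apply: H; last exact: ltW.
    - by move=> z; exact: sqr_ge0.
    - by move=> z; rewrite expr1 -sqrrN opprB; exact: gM.
  have {}H := le_trans (lee_wpmul2l _ (Hc x)) H.
  have {}H : b ^+ 2 * (c * w x) <= K * (C1 * w x).
    by rewrite -lee_fin EFinM H// lee_fin sqr_ge0.
  rewrite ler_pdivlMr// -(ler_pM2r (w0 x)).
  by move: H; rewrite !mulrA.
have := sqr_ge0 (b + (g x - g y)); have := gM x y; rewrite -/K.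
have K'0 : 0 <= K * C1 / c by exact: le_trans (sqr_ge0 b) Hb.
have : 0 <= (K * C1 / c) * enorm (vsub x y) ^+ 2 by rewrite mulr_ge0 ?sqr_ge0.
rewrite (_ : g y - mu x = b - (g x - g y)); last by rewrite /b; ring.
move: (enorm (vsub x y) ^+ 2) (K * C1 / c) Hb => s L Hb; move: (g x - g y) => t.
lra.
Qed.

(** Blyth's inequality with [k = cutoff N x]: the oscillation of the weight about
its value at [x] brings [s / (N + |x|^2)], the deviation of [g] brings [1 + s],
and the second moment of [1 + s] brings [w x]. *)
Lemma blyth_coordinate : exists2 C : R, 0 < C & forall N x (c : R), 1 <= N ->
  (\int[rho x]_y (cutoff N y ^+ 2 * (g y - mu x) ^+ 2)%:E <=
   \int[rho x]_y (cutoff N y ^+ 2 * (g y - c) ^+ 2)%:E +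
   (C * (w x / (N + enorm x ^+ 2)))%:E)%E.
Proof.
have [C0 C00 HC0] := rhoT_le; have [c2 c20 Hc2] := posterior_moment_ge u a0 2.
have [C2 C20 HC2] := rho_dominated 2; have [B B0 HB] := sqr_deviation_le.
(* L bounds the ratio of the integrals of h^2 + (h x)^2 and h^2 against rho x. *)
pose L : R := 1 + 4 * C0 / c2.
have L1 : 1 < L by rewrite ltrDl divr_gt0 ?mulr_gt0.
pose lam := (2 * L)^-1.
have lam0 : 0 < lam by rewrite invr_gt0 mulr_gt0// (lt_trans ltr01).
exists (lam^-1 * (4 * B * C2)); first by rewrite !mulr_gt0// invr_gt0.
move=> N x c N1.
have mG : measurable_fun setT (fun y => g y - mu x) by exact: measurable_funB.
have mh := @measurable_cutoff R p N.
have h01 y : 0 <= cutoff N y <= 1.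
  by rewrite cutoff_le1// ltW// cutoff_gt0.
have mh2 : measurable_fun setT (fun y => cutoff N y ^+ 2) by exact: (measurable_funX 2).
have Ih0 : (0 <= \int[rho x]_y (cutoff N y ^+ 2)%:E)%E.
  by apply: integral_ge0 => y _; rewrite lee_fin sqr_ge0.
have Hlow : ((cutoff N x ^+ 2 / 4 * (c2 * w x))%:E <=
    \int[rho x]_y (cutoff N y ^+ 2)%:E)%E.
  rewrite EFinM; apply: (le_trans (lee_wpmul2l _ (Hc2 x))).
    by rewrite lee_fin divr_ge0// sqr_ge0.
  rewrite -ge0_integralZl_EFin//; last 3 first.
  - move=> y _; rewrite lee_fin mulr_ge0 ?posterior_weight_ge0// invr_ge0 exprn_ge0//.
    by rewrite addr_ge0// sqr_ge0.
  - apply/measurable_EFinP; apply: measurable_funM.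
      exact: (measurableT_comp measurable_invr (measurable_1DX 2 x)).
    exact: measurable_posterior_weight.
  - by rewrite divr_ge0// sqr_ge0.
  rewrite integral_rho_EFin//; last by move=> y; exact: sqr_ge0.
  apply: ge0_le_integral => //.
  - move=> y _; rewrite -EFinM lee_fin; apply: mulr_ge0.
      by rewrite divr_ge0// sqr_ge0.
    by rewrite mulr_ge0 ?posterior_weight_ge0// invr_ge0 sqr_ge0.
  - apply: emeasurable_funM => //; apply/measurable_EFinP; apply: measurable_funM.
      exact: (measurableT_comp measurable_invr (measurable_1DX 2 x)).
    exact: measurable_posterior_weight.
  - apply/measurable_EFinP; apply: measurable_funM => //.
    exact: measurable_posterior_weight.
  move=> y _; rewrite -EFinM lee_fin mulrA ler_wpM2r ?posterior_weight_ge0//.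
  have s1 : 0 < 1 + enorm (vsub x y) ^+ 2 by rewrite ltr_pwDl// sqr_ge0.
  rewrite ler_pdivrMr ?exprn_gt0// ler_pdivrMr//.
  rewrite (_ : _ * 4 = (2 * (1 + enorm (vsub x y) ^+ 2) * cutoff N y) ^+ 2); last by ring.
  apply: lerXn2r; rewrite ?nnegrE; first exact/ltW/cutoff_gt0.
    by rewrite mulr_ge0 ?(ltW (cutoff_gt0 _ _))// mulr_ge0// ltW.
  exact: cutoff_peetre.
have Hh : ((cutoff N x ^+ 2)%:E * rho x setT <=
    (4 * C0 / c2)%:E * \int[rho x]_y (cutoff N y ^+ 2)%:E)%E.
  apply: (@le_trans _ _ (4 * C0 / c2 * (cutoff N x ^+ 2 / 4 * (c2 * w x)))%:E); last first.
    rewrite EFinM; apply: lee_wpmul2l Hlow.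
    by rewrite lee_fin divr_ge0 ?mulr_ge0// ltW.
  rewrite (_ : 4 * _ / _ * _ = cutoff N x ^+ 2 * (C0 * w x)); last first.
    by field; rewrite gt_eqF.
  by rewrite EFinM; apply: lee_wpmul2l (HC0 x); rewrite lee_fin sqr_ge0.
have Hlam : ((2 * lam)%:E * \int[rho x]_y (cutoff N y ^+ 2 + cutoff N x ^+ 2)%:E <=
    \int[rho x]_y (cutoff N y ^+ 2)%:E)%E.
  rewrite (_ : 2 * lam = L^-1); last by rewrite /lam; field; rewrite gt_eqF// (lt_trans ltr01).
  rewrite lee_pdivrMl ?(lt_trans ltr01)//.
  under eq_integral do rewrite EFinD.
  rewrite ge0_integralD//; last 3 first.
  - by move=> y _; rewrite lee_fin sqr_ge0.
  - exact/measurable_EFinP.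
  - by move=> y _; rewrite lee_fin sqr_ge0.
  rewrite integral_cst// /L EFinD ge0_muleDl ?lee_fin ?divr_ge0 ?mulr_ge0 ?(ltW C00) ?(ltW c20)//.
  by rewrite mul1e leeD2l.
have := blyth_local mG mh (rhoT_lty x) (sqr_shift_lty x (mu x)) (c - mu x)
  (integral_centered x) h01 lam0 Hlam.
under [X in (_ <= X + _)%E -> _]eq_integral.
  move=> y _; rewrite (_ : g y - mu x - (c - mu x) = g y - c); last by ring.
  over.
move=> /le_trans; apply; apply: leeD => //.
have X0 : 0 < N + enorm x ^+ 2 by rewrite ltr_pwDl ?sqr_ge0// (lt_le_trans ltr01).
rewrite (_ : lam^-1 * _ * _ = lam^-1 * (4 * B / (N + enorm x ^+ 2) * (C2 * w x))); last by ring.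
rewrite EFinM; apply: lee_wpmul2l; first by rewrite lee_fin invr_ge0 ltW.
apply: HC2.
- apply: measurable_funM; apply: (measurable_funX 2) => //.
  exact: measurable_funB.
- by move=> y; rewrite mulr_ge0 ?sqr_ge0.
- move=> y; have s0 := sqr_ge0 (enorm (vsub x y)).
  apply: (@le_trans _ _ (4 * enorm (vsub x y) ^+ 2 / (N + enorm x ^+ 2) *
    (B * (1 + enorm (vsub x y) ^+ 2)))).
    by apply: ler_pM; rewrite ?sqr_ge0// sqr_cutoffB_le.
  rewrite [leLHS](_ : _ = 4 * B / (N + enorm x ^+ 2) *
    (enorm (vsub x y) ^+ 2 * (1 + enorm (vsub x y) ^+ 2))); last by ring.
  rewrite ler_wpM2l ?divr_ge0 ?mulr_ge0 ?(ltW B0) ?(ltW X0)//.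
  by rewrite expr2 ler_wpM2r ?addr_ge0//; lra.
- by rewrite divr_ge0 ?mulr_ge0 ?(ltW B0) ?(ltW X0).
Qed.

End coordinate.

(** * Comparison of the weighted risks *)

Let nu : {measure set (vec R p) -> \bar R} := perturbed (prior p a) u.
Let kappa : R := (2 * pi) `^ (- (p%:R / 2)).
Let kappa0 : 0 <= kappa. Proof. exact: powR_ge0. Qed.

Lemma integral_nu (f : vec R p -> \bar R) : measurable_fun setT f ->
  (forall y, 0 <= f y)%E ->
  (\int[nu]_y f y = \int[leb]_y ((u y * w y)%:E * f y))%E.
Proof.
move=> mf f0; have mu' := measurable_perturbation u.
rewrite ge0_integral_density// ge0_integral_density//; last 2 first.
- by apply: emeasurable_funM => //; exact/measurable_EFinP.
- by move=> y; rewrite mule_ge0// lee_fin perturbation_ge0.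
by apply: eq_integral => y _; rewrite prior_densityE// muleA -EFinM mulrC.
Qed.

Section loss.
Variable delta : vec R p -> vec R q.
Hypothesis mdelta : measurable_fun setT delta.

Let loss x y := enorm (vsub (phi y) (delta x)) ^+ 2.

Let measurable_loss2 : measurable_fun setT (fun z : vec R p * vec R p => loss z.1 z.2).
Proof.
rewrite /loss; under eq_fun do rewrite sqr_enorm_vsubE.
apply: measurable_sum => i; apply: (measurable_funX 2); apply: measurable_funB.
  exact: (measurableT_comp (measurable_tnth i) (measurableT_comp mphi measurable_snd)).
exact: (measurableT_comp (measurable_tnth i) (measurableT_comp mdelta measurable_fst)).
Qed.

Let measurable_loss y : measurable_fun setT (loss ^~ y).
Proof.
exact: (measurableT_comp measurable_loss2 (measurable_pair2 y)).
Qed.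

Let measurable_lossr x : measurable_fun setT (loss x).
Proof.
exact: (measurableT_comp measurable_loss2 (measurable_pair1 x)).
Qed.

Let loss0 x y : 0 <= loss x y. Proof. exact: sqr_ge0. Qed.

Lemma riskE y : (risk phi delta y =
  \int[leb]_x (kappa * expR (- (enorm (vsub x y) ^+ 2 / 2)) * loss x y)%:E)%E.
Proof.
rewrite /risk ge0_integral_density//; last 2 first.
- by apply/measurable_EFinP; exact: (measurable_loss y).
- by move=> x; rewrite lee_fin sqr_ge0.
Qed.

Lemma risk_ge0 y : (0 <= risk phi delta y)%E.
Proof. by apply: integral_ge0 => x _; rewrite lee_fin sqr_ge0. Qed.

Lemma measurable_risk : measurable_fun setT (risk phi delta).
Proof.
have -> : risk phi delta = (fun y => \int[leb]_x (kappa *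
  expR (- (enorm (vsub x y) ^+ 2 / 2)) * loss x y)%:E)%E by apply/funext => y; exact: riskE.
apply: (measurable_fun_fubini_tonelli_G (fun z : vec R p * vec R p =>
   (kappa * expR (- (enorm (vsub z.1 z.2) ^+ 2 / 2)) * loss z.1 z.2)%:E)).
- apply/measurable_EFinP; apply: measurable_funM => //; apply: measurable_funM => //.
  exact: (measurableT_comp measurable_half_gauss measurable_sqr_enorm_vsub2).
- by move=> z; rewrite lee_fin mulr_ge0// mulr_ge0// expR_ge0.
Qed.

Let weighted_loss2 N : measurable_fun setT (fun z : vec R p * vec R p =>
  (cutoff N z.2 ^+ 2 * loss z.1 z.2 * W z.1 z.2)%:E).
Proof.
apply/measurable_EFinP; apply: measurable_funM => //; apply: measurable_funM => //.
by apply: (measurable_funX 2); exact: (measurableT_comp (measurable_cutoff N) measurable_snd).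
Qed.

Lemma rho_weighted_loss N x :
  (\int[rho x]_y (cutoff N y ^+ 2 * loss x y)%:E =
   \int[leb]_y (cutoff N y ^+ 2 * loss x y * W x y)%:E)%E.
Proof.
rewrite /rho integral_rho_EFin//.
  by apply: measurable_funM => //; apply: (measurable_funX 2); exact: measurable_cutoff.
by move=> y; rewrite mulr_ge0// sqr_ge0.
Qed.

Lemma posterior_loss_sum N x :
  (\int[rho x]_y (cutoff N y ^+ 2 * loss x y)%:E =
   \sum_(i < q) \int[rho x]_y
      (cutoff N y ^+ 2 * (tnth (phi y) i - tnth (delta x) i) ^+ 2)%:E)%E.
Proof.
rewrite -ge0_integral_sum//.
- apply: eq_integral => y _.
  by rewrite /loss sqr_enorm_vsubE mulr_sumr sumEFin.
- move=> i; apply/measurable_EFinP; apply: measurable_funM; apply: (measurable_funX 2).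
    exact: measurable_cutoff.
  apply: measurable_funB => //.
  exact: (measurableT_comp (measurable_tnth i) mphi).
- by move=> i y _; rewrite lee_fin mulr_ge0 ?sqr_ge0.
Qed.

Lemma measurable_posterior_loss N : measurable_fun setT
  (fun x => \int[rho x]_y (cutoff N y ^+ 2 * loss x y)%:E)%E.
Proof.
under eq_fun do rewrite rho_weighted_loss.
apply: (measurable_fun_fubini_tonelli_F (fun z : vec R p * vec R p =>
  (cutoff N z.2 ^+ 2 * loss z.1 z.2 * W z.1 z.2)%:E)) => //.
by move=> z; rewrite lee_fin mulr_ge0 ?posterior_weight_ge0// mulr_ge0 ?sqr_ge0.
Qed.

(** The Bayes risk under the prior [cutoff N ^ 2] times [nu], computed by
integrating over the parameter first. *)
Lemma weighted_riskE N :
  (\int[nu]_y ((cutoff N y ^+ 2)%:E * risk phi delta y) =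
   kappa%:E * \int[leb]_x \int[rho x]_y (cutoff N y ^+ 2 * loss x y)%:E)%E.
Proof.
have mc2 : measurable_fun setT (fun y : vec R p => cutoff N y ^+ 2).
  by apply: (measurable_funX 2); exact: measurable_cutoff.
rewrite integral_nu; last 2 first.
- by apply: emeasurable_funM; [exact/measurable_EFinP|exact: measurable_risk].
- by move=> y; rewrite mule_ge0 ?risk_ge0// lee_fin sqr_ge0.
transitivity (\int[leb]_y \int[leb]_x
   (kappa%:E * (cutoff N y ^+ 2 * loss x y * W x y)%:E))%E.
  apply: eq_integral => y _; rewrite muleA -EFinM riskE -ge0_integralZl_EFin//.
  - apply: eq_integral => x _; rewrite -!EFinM; congr _%:E.
    rewrite posterior_weightE; ring.
  - by move=> x _; rewrite lee_fin mulr_ge0// mulr_ge0// expR_ge0.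
  - apply/measurable_EFinP; apply: measurable_funM => //; apply: measurable_funM => //.
    exact: measurable_gauss_l.
  - by rewrite mulr_ge0 ?sqr_ge0// mulr_ge0 ?perturbation_ge0// ltW.
rewrite -(fubini_tonelli (fun z : vec R p * vec R p =>
   kappa%:E * (cutoff N z.2 ^+ 2 * loss z.1 z.2 * W z.1 z.2)%:E)%E); last 2 first.
- exact: emeasurable_funM.
- move=> z; rewrite -EFinM lee_fin mulr_ge0// mulr_ge0 ?posterior_weight_ge0//.
  by rewrite mulr_ge0 ?sqr_ge0.
rewrite -ge0_integralZl_EFin//; last 2 first.
- by move=> x _; apply: integral_ge0 => y _; rewrite lee_fin mulr_ge0 ?sqr_ge0.
- exact: measurable_posterior_loss.
apply: eq_integral => x _; rewrite rho_weighted_loss /= ge0_integralZl_EFin//.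
- by move=> y _; rewrite lee_fin mulr_ge0 ?posterior_weight_ge0// mulr_ge0 ?sqr_ge0.
- exact: (measurableT_comp (weighted_loss2 N) (measurable_pair1 x)).
Qed.

End loss.

Lemma measurable_formal_bayes : measurable_fun setT fb.
Proof.
apply/measurable_fun_tnthP => i.
exact: measurable_formal_bayes_coord.
Qed.

(** The squared error is at most a multiple of [1 + s], a Gaussian moment in the
observation. *)
Lemma bounded_risk_formal_bayes : exists2 C : R, 0 < C &
  forall y, (risk phi fb y <= C%:E)%E.
Proof.
have [C C0 HC] := @gauss_moment_le R p 1.
have /choice[B HB] : forall i, exists B : R, 0 < B /\ forall x y,
    (tnth (phi y) i - tnth (fb x) i) ^+ 2 <= B * (1 + enorm (vsub x y) ^+ 2).
  move=> i; have [B B0 HB] := sqr_deviation_le i.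
  by exists B.
pose S : R := \sum_i B i.
have S0 : 0 <= S by apply: sumr_ge0 => i _; have [/ltW] := HB i.
have HS x y : enorm (vsub (phi y) (fb x)) ^+ 2 <= S * (1 + enorm (vsub x y) ^+ 2).
  by rewrite sqr_enorm_vsubE mulr_suml; apply: ler_sum => i _; have [_] := HB i; apply.
exists (kappa * S * C + 1) => [|y].
  by rewrite ltr_wpDl// !mulr_ge0// ltW.
rewrite (riskE measurable_formal_bayes) (@le_trans _ _ (kappa * S * C)%:E)//; last first.
  by rewrite lee_fin lerDl.
apply: (@le_trans _ _ ((kappa * S)%:E * \int[leb]_x ((1 + enorm (vsub y x) ^+ 2) ^+ 1 *
     expR (- (enorm (vsub y x) ^+ 2 / 2)))%:E)%E); last first.
  by rewrite [leRHS]EFinM lee_wpmul2l// lee_fin mulr_ge0.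
have mE : measurable_fun setT (fun x => (1 + enorm (vsub y x) ^+ 2) ^+ 1 *
     expR (- (enorm (vsub y x) ^+ 2 / 2))).
  apply: (measurable_comp_sqdist (f := fun s => (1 + s) ^+ 1 * expR (- (s / 2)))).
  apply: measurable_funM; last exact: measurable_half_gauss.
  by apply: (measurable_funX 1); exact: measurable_funD.
rewrite -ge0_integralZl_EFin//; last 3 first.
- by move=> x _; rewrite lee_fin mulr_ge0 ?expR_ge0// expr1 addr_ge0// sqr_ge0.
- exact/measurable_EFinP.
- exact: mulr_ge0.
apply: ge0_le_integral => //.
- by move=> x _; rewrite lee_fin mulr_ge0 ?sqr_ge0// mulr_ge0 ?expR_ge0.
- apply/measurable_EFinP; apply: measurable_funM; last first.
    under eq_fun do rewrite sqr_enorm_vsubE.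
    apply: measurable_sum => i; apply: (measurable_funX 2); apply: measurable_funB => //.
    exact: (measurableT_comp (measurable_tnth i) measurable_formal_bayes).
  by apply: measurable_funM => //; exact: measurable_gauss_l.
- by apply: emeasurable_funM => //; exact/measurable_EFinP.
move=> x _; rewrite -EFinM lee_fin expr1 (enorm_vsubC y x).
rewrite [leRHS](_ : _ = kappa * expR (- (enorm (vsub x y) ^+ 2 / 2)) *
  (S * (1 + enorm (vsub x y) ^+ 2))); last by ring.
by apply: ler_wpM2l => //; rewrite mulr_ge0 ?expR_ge0.
Qed.

Let tail_mass : R := fine (\int[leb]_y (prior_tail a y)%:E)%E.

Let tail_mass_ge0 : 0 <= tail_mass.
Proof. by rewrite fine_ge0// integral_ge0// => y _; rewrite lee_fin prior_tail_ge0. Qed.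

Let measurable_tail : measurable_fun setT (fun y : vec R p => (prior_tail a y)%:E).
Proof. by apply/measurable_EFinP; exact: measurable_prior_tail. Qed.

Let integral_tailZ (k : R) : (0 < p)%N -> 0 <= k ->
  (\int[leb]_y (k%:E * (prior_tail a y)%:E) = (k * tail_mass)%:E)%E.
Proof.
move=> p0 k0; have I0 : (0 <= \int[leb]_y (prior_tail a y)%:E)%E.
  by apply: integral_ge0 => y _; rewrite lee_fin prior_tail_ge0.
rewrite ge0_integralZl_EFin//; last by move=> y _; rewrite lee_fin prior_tail_ge0.
by rewrite EFinM fineK// ge0_fin_numE// integral_prior_tail_lty.
Qed.

(** Sum [blyth_coordinate] over the coordinates and integrate over the observation;
[cutoff_den_le] leaves [1 / m] times the integral of the tail. *)
Lemma blyth_bound : (0 < p)%N -> exists2 C : R, 0 < C & forall (m : R) delta, 1 <= m ->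
  measurable_fun setT delta ->
  (\int[nu]_y ((cutoff (m ^+ 2) y ^+ 2)%:E * risk phi fb y) <=
   \int[nu]_y ((cutoff (m ^+ 2) y ^+ 2)%:E * risk phi delta y) + (C / m)%:E)%E.
Proof.
move=> p0.
have /choice[B HB] : forall i, exists B : R, 0 < B /\ forall N x (c : R), 1 <= N ->
  (\int[rho x]_y (cutoff N y ^+ 2 * (tnth (phi y) i - tnth (fb x) i) ^+ 2)%:E <=
   \int[rho x]_y (cutoff N y ^+ 2 * (tnth (phi y) i - c) ^+ 2)%:E +
   (B * (w x / (N + enorm x ^+ 2)))%:E)%E.
  move=> i; have [B B0 HB] := blyth_coordinate i.
  by exists B.
pose S : R := \sum_i B i.
have S0 : 0 <= S by apply: sumr_ge0 => i _; have [/ltW] := HB i.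
(* The summand 1 makes the constant positive. *)
exists (kappa * (S * tail_mass) + 1) => [|m delta m1 mdelta].
  by rewrite ltr_wpDl// !mulr_ge0.
have m0 : 0 < m by rewrite (lt_le_trans ltr01).
have N1 : 1 <= m ^+ 2 by rewrite exprn_ege1.
pose E x := w x / (m ^+ 2 + enorm x ^+ 2).
have E0 x : 0 <= E x.
  by rewrite mulr_ge0 ?invr_ge0 ?(ltW (w0 _))// addr_ge0 ?sqr_ge0.
rewrite (weighted_riskE measurable_formal_bayes) (weighted_riskE mdelta).
set A := fun x => (\int[rho x]_y (cutoff (m ^+ 2) y ^+ 2 *
  enorm (vsub (phi y) (fb x)) ^+ 2)%:E)%E.
set A1 := fun x => (\int[rho x]_y (cutoff (m ^+ 2) y ^+ 2 *
  enorm (vsub (phi y) (delta x)) ^+ 2)%:E)%E.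
have AA1 x : (A x <= A1 x + (S * E x)%:E)%E.
  rewrite /A /A1 posterior_loss_sum posterior_loss_sum mulr_suml -sumEFin -big_split/=.
  by apply: lee_sum => i _; have [_] := HB i; apply.
have mA : measurable_fun setT A by exact: (measurable_posterior_loss measurable_formal_bayes).
have mA1 : measurable_fun setT A1 by exact: (measurable_posterior_loss mdelta).
have A0 x : (0 <= A x)%E.
  by apply: integral_ge0 => y _; rewrite lee_fin mulr_ge0 ?sqr_ge0.
have A10 x : (0 <= A1 x)%E.
  by apply: integral_ge0 => y _; rewrite lee_fin mulr_ge0 ?sqr_ge0.
have mSE : measurable_fun setT (fun x => (S * E x)%:E).
  apply/measurable_EFinP; apply: measurable_funM => //.
  apply: measurable_funM; first exact: measurable_prior_weight.
  exact: (measurableT_comp measurable_invr (measurable_add_sqr_enorm (m ^+ 2))).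
have SE : (\int[leb]_x (S * E x)%:E <= (S / m * tail_mass)%:E)%E.
  rewrite -integral_tailZ// ?divr_ge0 ?(ltW m0)//.
  apply: ge0_le_integral => //.
  - by move=> x _; rewrite lee_fin mulr_ge0.
  - exact: emeasurable_funM.
  move=> x _; rewrite -EFinM lee_fin -mulrA ler_wpM2l// /E /prior_tail.
  rewrite mulrC mulrA ler_wpM2r ?(ltW (w0 _))//.
  exact: cutoff_den_le.
apply: (@le_trans _ _ (kappa%:E * (\int[leb]_x A1 x + (S / m * tail_mass)%:E))%E).
  apply: lee_wpmul2l => //.
  apply: (@le_trans _ _ (\int[leb]_x (A1 x + (S * E x)%:E))%E).
    apply: ge0_le_integral => //.
    - by move=> x _; exact: A0.
    - exact: emeasurable_funD.
    - by move=> x _; exact: AA1.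
  rewrite ge0_integralD//; last by move=> x _; rewrite lee_fin mulr_ge0.
  by rewrite leeD2l.
rewrite ge0_muleDr ?integral_ge0// ?lee_fin ?mulr_ge0 ?invr_ge0 ?(ltW m0)//.
rewrite leeD2l// -EFinM lee_fin ler_pdivlMr//.
rewrite (_ : _ * m = kappa * (S * tail_mass)); last by field; rewrite gt_eqF.
by rewrite lerDl.
Qed.

(** [h^2 <= h <= m / sqrt (1 + |y|^2)] for [h = cutoff (m ^+ 2)]. *)
Lemma cutoff_mass_lty (m : R) : (0 < p)%N -> 1 <= m ->
  (\int[nu]_y (cutoff (m ^+ 2) y ^+ 2)%:E < +oo)%E.
Proof.
move=> p0 m1; have m0 : 0 < m by rewrite (lt_le_trans ltr01).
have N1 : 1 <= m ^+ 2 by rewrite exprn_ege1.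
have [c c1 cu] := perturbation_bounded u.
have c0 : 0 < c by rewrite (lt_trans ltr01).
have mc2 : measurable_fun setT (fun y : vec R p => (cutoff (m ^+ 2) y ^+ 2)%:E).
  by apply/measurable_EFinP; apply: (measurable_funX 2); exact: measurable_cutoff.
rewrite integral_nu//; last by move=> y; rewrite lee_fin sqr_ge0.
apply: (@le_lt_trans _ _ (c * m * tail_mass)%:E); last exact: ltry.
rewrite -integral_tailZ ?mulr_ge0 ?(ltW c0) ?(ltW m0)//.
apply: ge0_le_integral => //.
- move=> y _; rewrite -EFinM lee_fin; apply: mulr_ge0; last exact: sqr_ge0.
  by rewrite mulr_ge0 ?perturbation_ge0// ltW.
- apply: emeasurable_funM => //; apply/measurable_EFinP; apply: measurable_funM.
    exact: measurable_perturbation.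
  exact: measurable_prior_weight.
- exact: emeasurable_funM.
move=> y _; rewrite -!EFinM lee_fin.
have /andP[_ uc] := cu y; have h0 := cutoff_gt0 y N1; have h1 := cutoff_le1 y N1.
have Hh : cutoff (m ^+ 2) y ^+ 2 <= m * (Num.sqrt (1 + enorm y ^+ 2))^-1.
  apply: (@le_trans _ _ (cutoff (m ^+ 2) y)).
    by rewrite expr2 ler_piMl// ltW.
  rewrite /cutoff; apply: (le_trans (ler_wpM2l (sqr_ge0 m) (cutoff_den_le y m1))).
  by rewrite mulrA expr2 mulfK ?gt_eqF.
rewrite /prior_tail [leRHS](_ : _ = c * w y * (m * (Num.sqrt (1 + enorm y ^+ 2))^-1)); last by ring.
apply: ler_pM => //; rewrite ?sqr_ge0 ?mulr_ge0 ?perturbation_ge0 ?(ltW (w0 _))//.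
by rewrite ler_wpM2r ?ltW.
Qed.

Lemma almost_admissible_formal_bayes : (0 < p)%N -> almost_admissible nu phi fb.
Proof.
move=> p0 delta mdelta dominates.
have [K K0 HK] := bounded_risk_formal_bayes.
have [C C0 HC] := blyth_bound p0.
apply: (@blyth_null_gain _ _ _ nu _ _ (fun m y => cutoff (m ^+ 2) y) K C) => //.
- exact: (measurable_risk measurable_formal_bayes).
- exact: (measurable_risk mdelta).
- by move=> y; exact: risk_ge0.
- by move=> m; exact: measurable_cutoff.
- by move=> y; rewrite cutoff_gt0// expr1n.
- by move=> m y m1; rewrite expr1n cutoff_mono// exprn_ege1.
- by move=> m m1; exact: cutoff_mass_lty.
- by move=> m m1; exact: HC.
Qed.

End bayes.

Theorem theorem4p1 (R : realType) (p : nat) (a d : R) :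
  (3 <= p)%N -> 0 < a -> 0 < d ->
  strongly_admissible a
    (fun theta eta : vec R p => enorm (vsub theta eta) ^+ 2 + d).
Proof.
move=> p3 a0 d0 u q phi q0 [mphi [M M0 phiM]].
exact: (almost_admissible_formal_bayes a0 d0 M0 mphi phiM (leq_trans (isT : 0 < 3)%N p3)).
Qed.
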